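(* Partial rejection sampling for the hard spheres model achieves expected packing density $\Omega(2^{-d})$ with $O(\log r^{-1})$ expected iterations. Explicitly: there is an absolute constant $c>0$ such that for every integer $d\ge2$ there exist $\lambda>0$, $C>0$ and $r_0\in(0,1)$ (depending only on $d$) such that for all $0<r\le r_0$: (i) the expected number of iterations of the while-loop in the partial rejection sampling algorithm in dimension $d$ with parameters $(\lambda,r)$ is at most $C\log(1/r)$; and (ii) the expected packing density of the hard spheres model in dimension $d$ with parameters $(\lambda,r)$ is at least $c\,2^{-d}$.
   Context: Let $v_d$ be the volume of the unit ball in $\mathbb R^d$ and $\lambda_{r,d}=\lambda/(v_dr^d)$; $\|\cdot\|$ is the Euclidean norm. For a finite set $P\subset[0,1]^d$, let $\mathrm{BadPairs}(P)=\{\{x,y\}: x,y\in P,\ x\neq y,\ \|x-y\|<2r\}$ and $\mathrm{BadPoints}(P)=\bigcup \mathrm{BadPairs}(P)$, i.e. the set of points of $P$ belonging to some bad pair. $D_{2r}(\mathbf 0)$ is the open ball of radius $2r$ centred at the origin of $\mathbb R^d$, and $+$ denotes Minkowski sum. The hard spheres model in dimension $d$ with parameters $(\lambda,r)$ is the law of a Poisson point process of intensity $\lambda_{r,d}$ on $[0,1]^d$ conditioned on no two distinct points being closer than $2r$. Its expected packing density is the expected total volume of the balls of radius $r$ centred at the points, i.e. $v_dr^d\,\mathbb E|X|$ where $X$ is distributed according to the model. The partial rejection sampling algorithm in dimension $d$ with parameters $(\lambda,r)$: 1. Let $P$ be a sample of the Poisson point process of intensity $\lambda_{r,d}$ on $[0,1]^d$.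 2. While $B:=\mathrm{BadPoints}(P)\neq\emptyset$: let $S=(B+D_{2r}(\mathbf 0))\cap[0,1]^d$; draw, using fresh independent randomness, a sample $P^S$ of the Poisson point process of intensity $\lambda_{r,d}$ on $S$; replace $P$ by $(P\setminus B)\cup P^S$. 3. Halt and output $P$. *)

(* Defs.v *)
From HB Require Import structures.
From mathcomp Require Import all_boot all_order all_algebra finmap.
From mathcomp Require Import all_classical all_reals all_analysis.
From mathcomp Require Import measurable_realfun.

Set Implicit Arguments.
Unset Strict Implicit.
Unset Printing Implicit Defensive.

Import Order.TTheory GRing.Theory Num.Theory.
Import numFieldNormedType.Exports.

Local Open Scope classical_set_scope.
Local Open Scope ring_scope.
Local Open Scope ereal_scope.

Section tuple_power.
Context d (T : measurableType d) (R : realType).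

Definition tcons n (p : (T * n.-tuple T)%type) : n.+1.-tuple T := [tuple of p.1 :: p.2].
Definition tuncons n (x : n.+1.-tuple T) : (T * n.-tuple T)%type :=
  (thead x, [tuple of behead x]).

Lemma measurable_tcons n : measurable_fun [set: (T * n.-tuple T)%type] (@tcons n).
Proof. exact: measurable_cons. Qed.

Lemma measurable_tuncons n : measurable_fun [set: n.+1.-tuple T] (@tuncons n).
Proof.
apply: measurable_fun_pair; last exact: measurable_behead.
exact: measurable_tnth.
Qed.

Lemma tconsK n : cancel (@tcons n) (@tuncons n).
Proof. by move=> [x y]; congr pair => //; exact: val_inj. Qed.

Lemma tunconsK n : cancel (@tuncons n) (@tcons n).
Proof. by move=> x; rewrite [RHS]tuple_eta; exact: val_inj. Qed.

Section cons_measure.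
Variables (n : nat) (mu : {sigma_finite_measure set T -> \bar R}).
Variable nu : {sigma_finite_measure set (n.-tuple T) -> \bar R}.

Definition cons_measure (A : set (n.+1.-tuple T)) : \bar R :=
  (mu \x nu) (@tcons n @^-1` A).

Let mtcons A : measurable A -> measurable (@tcons n @^-1` A).
Proof.
by move=> mA; rewrite -[X in measurable X]setTI; exact: measurable_tcons.
Qed.

Let cons_measure0 : cons_measure set0 = 0.
Proof. by rewrite /cons_measure preimage_set0 measure0. Qed.

Let cons_measure_ge0 A : 0 <= cons_measure A.
Proof. by rewrite /cons_measure; exact: measure_ge0. Qed.

Let cons_measure_sigma_additive : semi_sigma_additive cons_measure.
Proof.
move=> F mF tF mUF; rewrite /cons_measure preimage_bigcup.
apply: measure_semi_sigma_additive.
- by move=> i; exact: mtcons.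
- apply/trivIsetP => /= i j _ _ ij; rewrite -preimage_setI.
  by move/trivIsetP : tF => /(_ _ _ _ _ ij) ->//; rewrite preimage_set0.
- by rewrite -preimage_bigcup; exact: mtcons.
Qed.

HB.instance Definition _ := isMeasure.Build _ _ _ cons_measure
  cons_measure0 cons_measure_ge0 cons_measure_sigma_additive.

Let cons_measure_sigma_finite : sigma_finite setT cons_measure.
Proof.
have /sigma_finiteP[F [UF ndF Foo]] := sigma_finiteT mu.
have /sigma_finiteP[G [UG ndG Goo]] := sigma_finiteT nu.
exists (fun i => @tuncons n @^-1` (F i `*` G i)).
  rewrite -preimage_bigcup (_ : \bigcup_i (F i `*` G i) = setT) ?preimage_setT//.
  apply/seteqP; split => // -[x y] _.
  have [i _ Fx] : (\bigcup_i F i) x by rewrite -UF.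
  have [j _ Gy] : (\bigcup_i G i) y by rewrite -UG.
  exists (maxn i j) => //; split => /=.
  - by move: x Fx; exact/subsetPset/ndF/leq_maxl.
  - by move: y Gy; exact/subsetPset/ndG/leq_maxr.
move=> i; have [mF Fi] := Foo i; have [mG Gi] := Goo i.
have mFG : measurable (F i `*` G i) by exact: measurableX.
split.
  by rewrite -[X in measurable X]setTI; exact: measurable_tuncons.
rewrite /cons_measure -comp_preimage.
rewrite (_ : _ \o _ = id) ?preimage_id; last first.
  by apply/funext => p /=; rewrite tconsK.
by rewrite product_measure1E// lte_mul_pinfty// ge0_fin_numE.
Qed.

HB.instance Definition _ := Measure_isSigmaFinite.Build _ _ _ cons_measure
  cons_measure_sigma_finite.

End cons_measure.

(* The [n]-fold product of [mu], as a measure on [n]-tuples. *)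
Fixpoint power_measure (mu : {sigma_finite_measure set T -> \bar R}) n :
    {sigma_finite_measure set (n.-tuple T) -> \bar R} :=
  match n with
  | 0%N => \d_([tuple] : 0.-tuple T)
  | n'.+1 => cons_measure mu (power_measure mu n')
  end.

Lemma power_measure_setT (P : probability T R) n : power_measure P n setT = 1.
Proof.
elim: n => [|n IHn] /=; first exact: diracT.
rewrite /cons_measure preimage_setT -setXTT.
by rewrite product_measure1E// IHn mule1; exact: probability_setT.
Qed.

End tuple_power.

Section configurations.
Context d (T : measurableType d).

Definition fset_of_tuple n (x : n.-tuple T) : {fset T} := [fset y in tval x]%fset.

(* A set of finite configurations is measurable when, for each [n], so is the
   set of [n]-tuples enumerating (possibly with repetitions) one of its
   members. For [T = R^d] this is the usual sigma-algebra, generated by the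
   counting maps [P |-> #(P `&` B)], [B] Borel. *)
Definition fset_measurable : set_system {fset T} :=
  [set A | forall n, measurable (@fset_of_tuple n @^-1` A)].

Let fset_measurable0 : fset_measurable set0.
Proof. by move=> n; rewrite preimage_set0. Qed.

Let fset_measurableC A : fset_measurable A -> fset_measurable (~` A).
Proof. by move=> mA n; rewrite preimage_setC; apply: measurableC; exact: mA. Qed.

Let fset_measurable_bigcup (F : (set {fset T})^nat) :
  (forall i, fset_measurable (F i)) -> fset_measurable (\bigcup_i F i).
Proof.
move=> mF n; rewrite preimage_bigcup.
by apply: bigcup_measurable => i _; exact: mF.
Qed.

HB.instance Definition _ := isPointed.Build {fset T} fset0.
HB.instance Definition _ := @isMeasurable.Build d {fset T}
  fset_measurable fset_measurable0 fset_measurableC fset_measurable_bigcup.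

End configurations.

Section poisson_process.
Context d (T : measurableType d) (R : realType).
Variables (mu : {measure set T -> \bar R}) (a : R) (S : set T).
Hypothesis mS : measurable S.

(* A Dirac mass if [mu S = 0]; this value does not matter below, as a Poisson
   process on a null set has no points. *)
Definition uniform_on : probability T R := mnormalize (mrestr mu mS) (\d_point).

(* The law of the Poisson point process of intensity [a] on [S], for
   [mu S < +oo]: a Poisson number [k] of points, of mean [a * mu S], which given
   [k] are independent and uniform on [S]. *)
Definition poisson_process (A : set {fset T}) : \bar R :=
  \int[poisson_prob (a * fine (mu S)) 0]_k
    power_measure uniform_on k (@fset_of_tuple _ T k @^-1` A).

Let poisson_process0 : poisson_process set0 = 0.
Proof.
by apply: integral0_eq => k _; rewrite preimage_set0 measure0.
Qed.

Let poisson_process_ge0 A : 0 <= poisson_process A.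
Proof. by apply: integral_ge0 => k _; exact: measure_ge0. Qed.

Let poisson_process_sigma_additive : semi_sigma_additive poisson_process.
Proof.
move=> F mF tF mUF; rewrite [X in _ --> X](_ : _ = \sum_(n <oo) poisson_process (F n)).
  apply/cvg_closeP; split; last by rewrite closeE.
  by apply: is_cvg_nneseries => n _ _; exact: poisson_process_ge0.
rewrite -integral_nneseries//.
apply: eq_integral => k _; rewrite preimage_bigcup.
apply/esym/cvg_lim => //; apply: measure_semi_sigma_additive.
- by move=> n; exact: mF.
- apply/trivIsetP => /= i j _ _ ij; rewrite -preimage_setI.
  by move/trivIsetP : tF => /(_ _ _ _ _ ij) ->//; rewrite preimage_set0.
- by rewrite -preimage_bigcup; exact: mUF.
Qed.

HB.instance Definition _ := isMeasure.Build _ _ _ poisson_process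
  poisson_process0 poisson_process_ge0 poisson_process_sigma_additive.

Let poisson_process_setT : poisson_process setT = 1.
Proof.
rewrite /poisson_process (eq_integral (cst 1)) => [|k _]; last first.
  by rewrite preimage_setT power_measure_setT.
by rewrite integral_cst// mul1e; exact: probability_setT.
Qed.

HB.instance Definition _ := Measure_isProbability.Build _ _ _ poisson_process
  poisson_process_setT.

End poisson_process.

Local Close Scope ereal_scope.

Notation euclid R d := (d.-tuple (measurableTypeR R)).

Section euclidean_space.
Context (R : realType) (d : nat).
Implicit Types x y : euclid R d.

Definition volume : {sigma_finite_measure set (euclid R d) -> \bar R} :=
  power_measure (@lebesgue_measure R) d.

Definition enorm x : R := Num.sqrt (\sum_(i < d) (tnth x i : R) ^+ 2).

Definition tsub x y : euclid R d :=
  [tuple (tnth x i : R) - (tnth y i : R) | i < d].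

Definition edist x y : R := enorm (tsub x y).

Definition open_ball x (rho : R) : set (euclid R d) := [set z | edist z x < rho].

Definition unit_ball_volume : R := fine (volume [set x | enorm x <= 1]).

Definition cube : set (euclid R d) :=
  [set x | forall i, 0 <= (tnth x i : R) <= 1].

Lemma edist_eq0 x y : (edist x y == 0) = (x == y).
Proof.
rewrite /edist /enorm sqrtr_eq0.
set s := \sum_(i < d) _; have s0 : 0 <= s by apply: sumr_ge0 => i _; exact: sqr_ge0.
rewrite le_eqVlt ltNge s0 orbF {s0}/s psumr_eq0 => [|i _]; last exact: sqr_ge0.
apply/allP/eqP => [h|-> i _]; last by rewrite tnth_mktuple subrr expr0n/=.
apply/eq_from_tnth => i; have := h i (mem_index_enum i).
by rewrite tnth_mktuple /= sqrf_eq0 subr_eq0 => /eqP.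
Qed.

Lemma measurable_edist d' (T : measurableType d') (f g : T -> euclid R d) :
  measurable_fun setT f -> measurable_fun setT g ->
  measurable_fun setT (fun t => edist (f t) (g t)).
Proof.
move=> mf mg; rewrite /edist /enorm.
apply: (@measurableT_comp _ _ _ _ _ _ (@Num.sqrt R)).
  by apply: continuous_measurable_fun; exact: sqrt_continuous.
apply: measurable_sum => i; apply: measurable_funX.
under eq_fun do rewrite tnth_mktuple.
apply: measurable_funB.
- by move/measurable_fun_tnthP : mf; exact.
- by move/measurable_fun_tnthP : mg; exact.
Qed.

Lemma measurable_open_ball x rho : measurable (open_ball x rho).
Proof.
rewrite (_ : open_ball x rho = (fun z => edist z x) @^-1` `]-oo, rho[%classic).
  rewrite -[X in measurable X]setTI; apply: measurable_edist => //.
by apply/seteqP; split => z /=; rewrite in_itv.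
Qed.

Lemma measurable_cube : measurable cube.
Proof.
rewrite (_ : cube = \bigcap_(i in [set: 'I_d])
    ((fun z : euclid R d => tnth z i) @^-1` `[0 : R, 1]%classic)).
  apply: fin_bigcap_measurable => [|i _]; first exact: finite_finset.
  by rewrite -[X in measurable X]setTI; exact: measurable_tnth.
apply/seteqP; split => [z /= h i _ /=|z /= h i]; first by rewrite in_itv/= h.
by have := h i Logic.I; rewrite /= in_itv/=.
Qed.

End euclidean_space.

Arguments volume : clear implicits.
Arguments cube : clear implicits.
Arguments measurable_cube : clear implicits.

Section hard_spheres.
Context (R : realType) (d : nat) (lambda r : R).
Implicit Type P : {fset euclid R d}.

Definition intensity : R := lambda / (unit_ball_volume R d * r ^+ d).

Definition bad_pairs P : {fset {fset euclid R d}} :=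
  [fset [fset x; y] | x in P, y in P & (x != y) && (edist x y < 2 * r)]%fset.

Definition bad_points P : {fset euclid R d} :=
  (\bigcup_(e <- bad_pairs P) e)%fset.

Lemma bad_pairs_eq0 P : bad_pairs P = fset0 <->
  forall x y, x \in P -> y \in P -> x != y -> ~~ (edist x y < 2 * r).
Proof.
split=> [P0 x y xP yP xy|h].
  apply/negP => xyr; have : [fset x; y]%fset \in bad_pairs P.
    by apply/imfset2P; exists x => //; exists y => //; rewrite inE yP xy.
  by rewrite P0.
apply/eqP/fset0Pn => -[e /imfset2P[x xP [y]]].
rewrite inE => /andP[yP /andP[xy xyr]] _.
by have := h x y xP yP xy; rewrite xyr.
Qed.

Definition hard_core : set {fset euclid R d} := [set P | bad_pairs P = fset0].

Lemma measurable_hard_core : measurable hard_core.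
Proof.
move=> n; rewrite (_ : _ @^-1` _ = \bigcap_(ij in [set: 'I_n * 'I_n])
  ~` ((fun z : n.-tuple (euclid R d) => edist (tnth z ij.1) (tnth z ij.2)) @^-1`
      [set s | 0 < s < 2 * r])).
  apply: fin_bigcap_measurable => [|[i j] _ /=]; first exact: finite_finset.
  apply: measurableC.
  rewrite -[X in measurable X]setTI.
  apply: measurable_edist => //; first exact: measurable_tnth.
    exact: measurable_tnth.
  rewrite (_ : [set s | _] = `]0, 2 * r[%classic); first exact: measurable_itv.
  by apply/seteqP; split => s /=; rewrite in_itv.
apply/seteqP; split => [z /bad_pairs_eq0 h [i j] _ /= /andP[d0 dr]|z h].
  have := h (tnth z i) (tnth z j); rewrite !inE /= !mem_tnth dr.
  by rewrite -edist_eq0 gt_eqF// => /(_ isT isT isT).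
apply/bad_pairs_eq0 => x y; rewrite !inE /= => /tnthP[i ->] /tnthP[j ->].
rewrite -edist_eq0 => d0; apply/negP => dr; apply: (h (i, j)) => //=.
by rewrite dr andbT lt_neqAle eq_sym d0 sqrtr_ge0.
Qed.

(* The Poisson process conditioned on being hard-core: the restricted measure
   is renormalised, and its mass is positive since [fset0] is hard-core. *)
Definition hard_spheres : probability {fset euclid R d} R :=
  mnormalize
    (mrestr (poisson_process (volume R d) intensity (measurable_cube R d))
            measurable_hard_core)
    \d_fset0.

Definition packing_density : \bar R :=
  ((unit_ball_volume R d * r ^+ d)%:E *
   \int[hard_spheres]_P (#|` P|%:R)%:E)%E.

Definition resampling_set P : set (euclid R d) :=
  (\bigcup_(x in [set` bad_points P]) open_ball x (2 * r)) `&` cube R d.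

Lemma measurable_resampling_set P : measurable (resampling_set P).
Proof.
apply: measurableI; last exact: measurable_cube.
by apply: fin_bigcup_measurable => // x _; exact: measurable_open_ball.
Qed.

(* The law of [(P `\` bad_points P) `|` Q] for [Q] a Poisson process on the
   resampling set of [P]. If [P] has no bad points, that set is empty and this is
   the Dirac mass at [P]. *)
Definition prs_step P (A : set {fset euclid R d}) : \bar R :=
  poisson_process (volume R d) intensity (measurable_resampling_set P)
    [set Q | A (P `\` bad_points P `|` Q)%fset].

Section run.
Context d' (Omega : measurableType d').

Definition history (X : nat -> Omega -> {fset euclid R d}) t : set (set Omega) :=
  <<s \bigcup_(s in `I_t.+1) preimage_set_system setT (X s) measurable >>.

(* [X t] is the configuration after [t] passes through the loop body, and keeps
   its value once there are no bad points. The freshness of the randomness used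
   in each pass is expressed by the conditional law of [X t.+1] given
   [X 0, ..., X t]. *)
Definition prs_run (Pr : probability Omega R)
    (X : nat -> Omega -> {fset euclid R d}) :=
  [/\ forall t, measurable_fun setT (X t),
      forall A, measurable A -> Pr (X 0%N @^-1` A) =
        poisson_process (volume R d) intensity (measurable_cube R d) A &
      forall t H A, history X t H -> measurable A ->
        Pr (H `&` X t.+1 @^-1` A) = (\int[Pr]_(w in H) prs_step (X t w) A)%E].

(* The first time at which there are no bad points; [+oo] if there is none. *)
Definition iterations (X : nat -> Omega -> {fset euclid R d}) w : \bar R :=
  ereal_inf [set t%:R%:E | t in [set t | bad_points (X t w) = fset0]].

End run.

End hard_spheres.

(* Main.v *)
Require Import Defs.
From HB Require Import structures.
From mathcomp Require Import all_boot all_order all_algebra finmap.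
From mathcomp Require Import all_classical all_reals all_analysis.
From mathcomp Require Import measurable_realfun giry.
From mathcomp Require Import ring lra.

(* The key quantity is the expected number of bad points.  Given the current
   configuration P with good part A = P \ Bad(P) and resampling set S, the next
   configuration is A together with a Poisson process Q on S.  New bad pairs
   have one or two points in Q.  The pairs inside Q are counted by Mecke's
   formula.  For the pairs between Q and A one needs that, averaged over the run,
   the good points are no denser than the Poisson process.  This is the
   inequality
     E sum_(y in A) F(y, P \ y) <= a E int_cube F(y, P) dy     for all F >= 0,
   where a is the intensity.  It holds initially by Mecke's formula, and it is
   preserved by the loop because a good point y lies outside S and removing it
   from P changes neither Bad(P) nor S.  If V
   bounds the volume of a ball of radius 2r, both kinds of pairs together give
     E |Bad(P_(t+1))| <= 3 (a V)^2 E |Bad(P_t)|,     E |Bad(P_0)| <= a^2 V.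
   With lambda = 2^-d / 2 one has a V = 1/2, so the expectation decays like
   (3/4)^t from O(r^-d), and summing min(1, E |Bad(P_t)|) over t gives
   O(log (1/r)).  Mecke's formula for the indicator of the hard-core
   configurations also yields E|X| >= a / (1 + a V), that is, a packing density
   of at least lambda / (1 + a V) = 2^-d / 3. *)

Set Implicit Arguments.
Unset Strict Implicit.
Unset Printing Implicit Defensive.

Import Order.TTheory GRing.Theory Num.Theory.
Import numFieldNormedType.Exports.

Local Open Scope classical_set_scope.
Local Open Scope ring_scope.
Local Open Scope ereal_scope.

Local Notation edist := Defs.edist.

(** * Measurability of functions of finite sequences *)

(** After a few passes the law of the configuration has no usable formula, so the density of its
    good points is controlled by an inequality that survives a pass. It must hold for every [F] of a
    point and the remaining configuration: one pass turns even an [F] of the point alone into a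
    functional that sees the resampling set. The induction closes because the cube splits in two:
    outside the resampling set the induction hypothesis accounts for the old good points, inside it
    Mecke's formula accounts for the fresh ones, and the two integrals add up to a one-step
    expectation over the whole cube.

    Decay needs [3 (a V)^2 < 1], and [a V = 1/2] makes this ratio [3/4]. Since [V] is [v (2 r)^d]
    while the intensity is normalised by [v r^d], this choice fixes [lambda] at the order [2^-d],
    which is the order of the packing density.

    Poisson expectations are expanded into series of iterated integrals of functions of finite
    sequences, where Tonelli's theorem and shifts of the index are at hand. Finite sets are reached
    through their enumerations, which almost surely have no repetition because single points are
    null. *)

(** The hypothesis on [m] makes it the bind of [m1] and [k] in the Giry monad, whose integration
    formula is the claim. It serves twice: for the mixture over the number of Poisson points and for
    the transitions of the run. *)
Lemma integral_mixture d1 d2 (T1 : measurableType d1) (T2 : measurableType d2)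
    (R : realType) (m1 : probability T1 R) (k : T1 -> giry T2 R)
    (m : {measure set T2 -> \bar R}) (f : T2 -> \bar R) :
    (forall A, measurable A -> measurable_fun setT (fun x => k x A)) ->
    (forall A, measurable A -> m A = \int[m1]_x k x A) ->
    measurable_fun setT f -> (forall y, 0 <= f y) ->
  \int[m]_y f y = \int[m1]_x \int[k x]_y f y.
Proof.
move=> mk mE mf f0.
have mg : measurable_fun setT k by exact: measurable_giry_codensity.
pose p : giry T1 R := m1.
rewrite -[RHS](giry_int_bind p mg mf f0); apply: eq_measure_integral => A mA _.
rewrite mE// /giry_bind/= giry_int_map//; exact: measurable_giry_ev.
Qed.

Section parametric_measurability.
Context d (T : measurableType d).

Lemma measurable_comp_fun d1 d2 d3 (T1 : measurableType d1) (T2 : measurableType d2)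
    (T3 : measurableType d3) (g : T2 -> T3) (f : T1 -> T2) :
  measurable_fun setT g -> measurable_fun setT f ->
  measurable_fun setT (fun x => g (f x)).
Proof. exact: measurableT_comp. Qed.

(* Joint measurability in a parameter and in a sequence of any given length. *)
Definition pmeas dZ (Z : measurableType dZ) dU (U : measurableType dU)
    (f : Z -> seq T -> U) :=
  forall n, measurable_fun [set: (Z * n.-tuple T)%type] (fun p => f p.1 p.2).

Lemma pmeas_comp dZ (Z : measurableType dZ) dZ' (Z' : measurableType dZ')
    dU (U : measurableType dU) (f : Z -> seq T -> U) (h : Z' -> Z) :
  measurable_fun setT h -> pmeas f -> pmeas (fun z => f (h z)).
Proof.
move=> mh mf n.
apply: (measurable_comp_fun (f := fun p => (h p.1, p.2)) (mf n)).
by apply: measurable_fun_pair => //; exact: measurableT_comp.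
Qed.

Lemma measurable_pcons dZ (Z : measurableType dZ) n :
  measurable_fun [set: ((Z * T) * n.-tuple T)%type]
    (fun p => (p.1.1, tcons (p.1.2, p.2)) : (Z * n.+1.-tuple T)%type).
Proof.
apply: measurable_fun_pair => /=.
  by apply: measurableT_comp => //; exact: measurable_fst.
apply: (measurable_comp_fun (f := fun p => (p.1.2, p.2)) (@measurable_tcons _ T n)).
by apply: measurable_fun_pair => //; apply: measurableT_comp.
Qed.

Lemma pmeas_cons dZ (Z : measurableType dZ) dU (U : measurableType dU)
    (f : Z -> seq T -> U) :
  pmeas f -> pmeas (fun (p : (Z * T)%type) s => f p.1 (p.2 :: s)).
Proof.
move=> mf n.
exact: (measurable_comp_fun (mf n.+1) (@measurable_pcons _ Z n)).
Qed.

(* Inductions on the length move the head into the parameter, so they generalize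
   over the parameter space. *)
Lemma measurable_uncons dZ (Z : measurableType dZ) dU (U : measurableType dU) n
    (f : Z -> seq T -> U) :
  measurable_fun [set: ((Z * T) * n.-tuple T)%type]
    (fun p => f p.1.1 (p.1.2 :: p.2)) ->
  measurable_fun [set: (Z * n.+1.-tuple T)%type] (fun p => f p.1 p.2).
Proof.
move=> mf.
pose h (p : Z * n.+1.-tuple T) := ((p.1, thead p.2), (tuncons p.2).2).
rewrite (_ : (fun p => _) =
    (fun p : Z * n.+1.-tuple T => f (h p).1.1 ((h p).1.2 :: (h p).2))); last first.
  by apply/funext => -[z q] /=; rewrite [in LHS](tuple_eta q).
apply: (measurable_comp_fun mf); apply: measurable_fun_pair => /=.
  apply: measurable_fun_pair => //=.
  apply: (measurable_comp_fun (g := fun q : n.+1.-tuple T => thead q)) => //.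
  exact: measurable_tnth.
apply: (measurable_comp_fun (g := fun q : n.+1.-tuple T => (tuncons q).2)) => //.
by apply: measurableT_comp => //; exact: measurable_tuncons.
Qed.

Lemma pmeas_nil dZ (Z : measurableType dZ) dU (U : measurableType dU)
    (f : Z -> seq T -> U) :
  pmeas f -> measurable_fun setT (f ^~ [::]).
Proof.
move=> mf.
apply: (measurable_comp_fun (f := fun z : Z => (z, [tuple] : 0.-tuple T)) (mf 0%N)).
exact: measurable_fun_pair.
Qed.

(** The entries of the prefix move one at a time into the parameter. This is what handles unions of
    two configurations that both vary. *)
Lemma pmeas_cat n dZ (Z : measurableType dZ) dU (U : measurableType dU)
    (f : Z -> seq T -> U) : pmeas f ->
  pmeas (fun (p : (Z * n.-tuple T)%type) s => f p.1 (p.2 ++ s)).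
Proof.
elim: n dZ Z f => [|n IHn] dZ Z f mf m.
  have := pmeas_comp (@measurable_fst _ _ Z (0.-tuple T)) mf.
  move=> /(_ m); apply: eq_measurable_fun => -[[z q] s] _ /=.
  by rewrite (tuple0 q).
have mg := IHn _ _ _ (pmeas_cons mf) m.
pose h (p : (Z * n.+1.-tuple T) * m.-tuple T) :=
  (((p.1.1, thead p.1.2), (tuncons p.1.2).2), p.2).
rewrite (_ : (fun p => _) = (fun p : (Z * n.+1.-tuple T) * m.-tuple T =>
    f (h p).1.1.1 ((h p).1.1.2 :: (h p).1.2 ++ (h p).2))); last first.
  by apply/funext => -[[z q] s] /=; rewrite [in LHS](tuple_eta q).
apply: (measurable_comp_fun mg); apply: measurable_fun_pair => //=.
apply: measurable_fun_pair => //=.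
  apply: measurable_fun_pair => //=; first exact: measurableT_comp.
  apply: (measurable_comp_fun (g := fun q : n.+1.-tuple T => thead q)).
    exact: measurable_tnth.
  by apply: measurableT_comp.
apply: (measurable_comp_fun (g := fun q : n.+1.-tuple T => (tuncons q).2)) => //.
  by apply: measurableT_comp => //; exact: measurable_tuncons.
by apply: measurableT_comp.
Qed.

Lemma pmeas_has dZ (Z : measurableType dZ) (p : Z -> T -> bool) :
  measurable_fun [set: (Z * T)%type] (fun z => p z.1 z.2) ->
  pmeas (fun z s => has (p z) s).
Proof.
move=> mp n; elim: n dZ Z p mp => [|n IHn] dZ Z p mp.
  rewrite (_ : (fun _ => _) = cst false)//.
  by apply/funext => -[z q] /=; rewrite (tuple0 q).
apply: (measurable_uncons (f := fun z s => has (p z) s)) => /=.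
apply: measurable_or; first exact: (measurable_comp_fun mp).
apply: (IHn _ (Z * T)%type (fun z => p z.1)).
apply: (measurable_comp_fun (f := fun z : (Z * T) * T => (z.1.1, z.2)) mp).
by apply: measurable_fun_pair => //; exact: measurableT_comp.
Qed.

(** Kept or discarded, the head moves into the parameter, and both branches are instances of the
    induction hypothesis. The good part of a configuration is such a filter. *)
Lemma pmeas_filter dZ (Z : measurableType dZ) dU (U : measurableType dU)
    (f : Z -> seq T -> U) (p : Z -> T -> bool) :
  measurable_fun [set: (Z * T)%type] (fun z => p z.1 z.2) -> pmeas f ->
  pmeas (fun z s => f z (seq.filter (p z) s)).
Proof.
move=> mp mf n; elim: n dZ Z f p mp mf => [|n IHn] dZ Z f p mp mf.
  apply: (eq_measurable_fun (fun q => f q.1 [::])) => [[z q] _ /=|].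
    by rewrite (tuple0 q).
  by apply: (measurable_comp_fun (g := f^~ [::])) => //; exact: pmeas_nil.
apply: (measurable_uncons (f := fun z s => f z (seq.filter (p z) s))) => /=.
have mp' : measurable_fun [set: ((Z * T) * T)%type] (fun z => p z.1.1 z.2).
  apply: (measurable_comp_fun (g := fun z : Z * T => p z.1 z.2)
    (f := fun z : (Z * T) * T => (z.1.1, z.2)) mp).
  by apply: measurable_fun_pair => //; exact: measurableT_comp.
apply: (eq_measurable_fun (fun q : (Z * T) * n.-tuple T =>
    if p q.1.1 q.1.2 then f q.1.1 (q.1.2 :: seq.filter (p q.1.1) q.2)
    else f q.1.1 (seq.filter (p q.1.1) q.2))) => [q _|].
  by case: ifP.
apply: measurable_fun_ifT.
- exact: (measurable_comp_fun mp).
- exact: (IHn _ (Z * T)%type (fun z s => f z.1 (z.2 :: s)) (fun z => p z.1) mp' (pmeas_cons mf)).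
- by apply: (IHn _ (Z * T)%type (fun z s => f z.1 s) (fun z => p z.1) mp'); exact: pmeas_comp.
Qed.

End parametric_measurability.

Section sequence_functions.
Context d (T : measurableType d).

Definition smeas dU (U : measurableType dU) (f : seq T -> U) :=
  forall n, measurable_fun [set: n.-tuple T] (fun q => f q).

Lemma pmeas_smeas dZ (Z : measurableType dZ) dU (U : measurableType dU)
  (f : Z -> seq T -> U) z : pmeas f -> smeas (f z).
Proof.
move=> mf n.
apply: (measurable_comp_fun (f := fun q : n.-tuple T => (z, q)) (mf n)).
exact: measurable_fun_pair.
Qed.

Lemma smeas_pmeas dZ (Z : measurableType dZ) dU (U : measurableType dU)
  (f : seq T -> U) : smeas f -> pmeas (fun _ : Z => f).
Proof. by move=> mf n; exact: (measurable_comp_fun (mf n)). Qed.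

Lemma smeas_cons dU (U : measurableType dU) (f : seq T -> U) :
  smeas f -> pmeas (fun x s => f (x :: s)).
Proof. by move=> mf n; exact: (measurable_comp_fun (mf n.+1) (@measurable_tcons _ T n)). Qed.

Lemma smeas_head dU (U : measurableType dU) (f : seq T -> U) x :
  smeas f -> smeas (fun s => f (x :: s)).
Proof. by move=> mf; exact: (pmeas_smeas x (smeas_cons mf)). Qed.

End sequence_functions.

(** * Iterated integrals of functions of sequences, and almost sure distinctness *)

Section iterated_integral.
Context d (T : measurableType d) (R : realType).
Variable mu : {sigma_finite_measure set T -> \bar R}.
Implicit Types (S : set T) (phi psi : seq T -> \bar R).

Lemma measurable_section dZ (Z : measurableType dZ) (S : Z -> set T) z :
  measurable [set p : (Z * T)%type | S p.1 p.2] -> measurable (S z).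
Proof.
move=> mS; rewrite (_ : S z = xsection [set p : (Z * T)%type | S p.1 p.2] z).
  exact: measurable_xsection.
by apply/seteqP; split => x; rewrite /xsection /= inE.
Qed.

(** Extending [g] by zero off the graph of [S] turns a domain that varies with [z] into a case of
    Tonelli's measurability theorem. The resampling set, which depends on the configuration, is such
    a domain. *)
Lemma measurable_section_integral dZ (Z : measurableType dZ) (S : Z -> set T)
    (g : Z -> T -> \bar R) :
  measurable [set p : (Z * T)%type | S p.1 p.2] ->
  measurable_fun [set: (Z * T)%type] (fun p => g p.1 p.2) ->
  (forall z x, 0 <= g z x) ->
  measurable_fun setT (fun z => \int[mu]_(x in S z) g z x).
Proof.
move=> mS mg g0.
pose h : Z * T -> \bar R := (fun p => g p.1 p.2) \_ [set p | S p.1 p.2].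
rewrite (_ : (fun z => _) = (fun z => \int[mu]_x h (z, x))); last first.
  apply/funext => z; rewrite integral_mkcond; apply: eq_integral => x _.
  by rewrite /h /patch; congr (if _ then _ else _); apply/idP/idP; rewrite !inE.
apply: (measurable_fun_fubini_tonelli_F h).
  apply/measurable_restrict => //; rewrite setTI.
  exact: measurable_funTS.
by move=> p; rewrite /h /patch; case: ifP.
Qed.

(* The integral of [phi [:: x_1; ...; x_k]] over all [x_i] in [S]. *)
Fixpoint iint S k phi : \bar R :=
  if k is k'.+1 then \int[mu]_(x in S) iint S k' (fun s => phi (x :: s))
  else phi [::].

Lemma iint_ge0 S k phi : (forall s, 0 <= phi s) -> 0 <= iint S k phi.
Proof.
elim: k phi => [|k IHk] phi phi0 //=.
by apply: integral_ge0 => x _; exact: IHk.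
Qed.

Lemma measurable_iint dZ (Z : measurableType dZ) (S : Z -> set T) k
    (phi : Z -> seq T -> \bar R) :
  measurable [set p : (Z * T)%type | S p.1 p.2] ->
  pmeas phi -> (forall z s, 0 <= phi z s) ->
  measurable_fun setT (fun z => iint (S z) k (phi z)).
Proof.
elim: k dZ Z S phi => [|k IHk] dZ Z S phi mS mphi phi0 /=; first exact: pmeas_nil.
apply: measurable_section_integral => //; last first.
  by move=> z x; exact: iint_ge0.
apply: (IHk _ (Z * T)%type (fun p => S p.1) (fun p s => phi p.1 (p.2 :: s))) => //.
  rewrite -[X in measurable X]setTI.
  apply: (measurable_fun_pair (f := fun p : (Z * T) * T => p.1.1) _ _ _ mS) => //.
  exact: measurableT_comp.
exact: pmeas_cons.
Qed.

Lemma measurable_const_section dZ (Z : measurableType dZ) S :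
  measurable S -> measurable [set p : (Z * T)%type | S p.2].
Proof. by move=> mS; rewrite -[X in measurable X]setTI; exact: measurable_snd. Qed.

Lemma measurable_iint_cons S k phi : measurable S -> smeas phi ->
  (forall s, 0 <= phi s) ->
  measurable_fun setT (fun x => iint S k (fun s => phi (x :: s))).
Proof.
move=> mS mphi phi0.
apply: (@measurable_iint _ _ (fun=> S) k (fun x s => phi (x :: s))) => //.
  exact: measurable_const_section.
exact: smeas_cons.
Qed.

Lemma iintD S k phi psi : measurable S -> smeas phi -> smeas psi ->
  (forall s, 0 <= phi s) -> (forall s, 0 <= psi s) ->
  iint S k (fun s => phi s + psi s) = iint S k phi + iint S k psi.
Proof.
move=> mS; elim: k phi psi => [|k IHk] phi psi mphi mpsi phi0 psi0 //=.
rewrite -ge0_integralD//; first 1 last.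
- by move=> x _; exact: iint_ge0.
- by apply: measurable_funTS; exact: measurable_iint_cons.
- by move=> x _; exact: iint_ge0.
- by apply: measurable_funTS; exact: measurable_iint_cons.
by apply: eq_integral => x _; rewrite -IHk//; exact: smeas_head.
Qed.

(** Tonelli's theorem, one coordinate at a time: the induction hypothesis moves the integral over
    [D] past the tail, and one exchange, with the integrand extended by zero off the product of [S]
    and [D], moves it past the head. *)
Lemma iint_integral S k dZ (Z : measurableType dZ)
    (nu : {sigma_finite_measure set Z -> \bar R}) (D : set Z)
    (phi : Z -> seq T -> \bar R) :
  measurable S -> measurable D -> pmeas phi -> (forall z s, 0 <= phi z s) ->
  iint S k (fun s => \int[nu]_(z in D) phi z s) =
  \int[nu]_(z in D) iint S k (phi z).
Proof.
move=> mS mD; elim: k phi => [|k IHk] phi mphi phi0 //=.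
transitivity (\int[mu]_(x in S) \int[nu]_(z in D) iint S k (fun s => phi z (x :: s))).
  apply: eq_integral => x _; rewrite (IHk (fun z s => phi z (x :: s)))//.
  exact: (pmeas_comp (h := fun z : Z => (z, x)) (pair2_measurable x) (pmeas_cons mphi)).
pose g (p : T * Z) := iint S k (fun s => phi p.2 (p.1 :: s)).
have mg : measurable_fun setT g.
  apply: (@measurable_iint _ _ (fun=> S) k (fun p s => phi p.2 (p.1 :: s))) => //.
    exact: measurable_const_section.
  have mh : measurable_fun setT (fun p : T * Z => (p.2, p.1)) by exact: measurable_fun_pair.
  exact: (pmeas_comp mh (pmeas_cons mphi)).
have g0 p : 0 <= g p by exact: iint_ge0.
have E := @fubini_tonelli _ _ _ _ _ mu nu (g \_ (S `*` D)).
transitivity (\int[mu]_x \int[nu]_z (g \_ (S `*` D)) (x, z)).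
  rewrite integral_mkcond; apply: eq_integral => x _; rewrite {1}/patch.
  case: ifPn => [xS|xS].
    rewrite integral_mkcond; apply: eq_integral => z _.
    by rewrite /patch; congr (if _ then _ else _); apply/idP/idP; rewrite !inE /=;
      [move=> ?; split => //; exact/set_mem|case].
  rewrite integral0_eq// => z _; rewrite /patch ifF//; apply/negP.
  by rewrite inE => -[] /= /mem_set; rewrite (negbTE xS).
rewrite E//; last 2 first.
- apply/measurable_restrict => //; first exact: measurableX.
  exact: measurable_funTS.
- by move=> p; rewrite /patch; case: ifP.
rewrite [RHS]integral_mkcond; apply: eq_integral => z _; rewrite [RHS]/patch.
case: ifPn => [zD|zD].
  rewrite [RHS]integral_mkcond; apply: eq_integral => x _.
  by rewrite /patch; congr (if _ then _ else _); apply/idP/idP; rewrite !inE /=;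
    [case|move=> ?; split => //; exact/set_mem].
rewrite integral0_eq// => x _; rewrite /patch ifF//; apply/negP.
by rewrite inE => -[] /= _ /mem_set; rewrite (negbTE zD).
Qed.

Hypothesis mu1 : forall x, measurable [set x] /\ mu [set x] = 0.

Lemma negligible_seq (l : seq T) :
  measurable [set x | x \in l] /\ mu [set x | x \in l] = 0.
Proof.
elim: l => [|y l [ml l0]].
  by rewrite (_ : [set _ | _] = set0) ?measure0//; apply/seteqP; split.
have [my y0] := mu1 y.
rewrite (_ : [set x | x \in y :: l] = [set y] `|` [set x | x \in l]).
  by split; [exact: measurableU|rewrite measureU0].
apply/seteqP; split => x /=; rewrite inE.
  by case/orP => [/eqP->|]; [left|right].
by case=> [->|->]; rewrite ?eqxx ?orbT.
Qed.

(* The points are almost surely distinct; the list [l] of points to avoid is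
   there for the induction. *)
Lemma le_iint S k (l : seq T) phi psi : measurable S -> smeas phi -> smeas psi ->
    (forall s, 0 <= phi s) -> (forall s, 0 <= psi s) ->
    (forall s, uniq s -> (forall x, x \in s -> x \notin l /\ S x) ->
      phi s <= psi s) ->
  iint S k phi <= iint S k psi.
Proof.
move=> mS; elim: k l phi psi => [|k IHk] l phi psi mphi mpsi phi0 psi0 h /=.
  exact: h.
have [ml l0] := negligible_seq l.
apply: ae_ge0_le_integral => //.
- by move=> x _; exact: iint_ge0.
- by apply: measurable_funTS; exact: measurable_iint_cons.
- by move=> x _; exact: iint_ge0.
- by apply: measurable_funTS; exact: measurable_iint_cons.
(* Heads in [l] form a null set. Any other head joins the list to avoid, which keeps the later
   entries distinct from it. *)
exists [set x | x \in l]; split => // x /=; apply: contra_notT => xl Sx.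
apply: (IHk (x :: l)) => //; [exact: smeas_head|exact: smeas_head|].
move=> s us hs; apply: h => /= [|y].
  by rewrite us andbT; apply/negP => /hs[]; rewrite inE eqxx.
rewrite inE => /orP[/eqP->//|/hs[]].
by rewrite inE negb_or => /andP[].
Qed.

End iterated_integral.

(** * Measurability of functions of finite configurations *)

Section configuration_functions.
Context d (T : measurableType d).

Definition fset_of_seq (s : seq T) : {fset T} := [fset y in s]%fset.

(** Stated on enumerations rather than on the product of [Z] with the space of configurations, so
    that inductions on the length apply. *)
Definition cmeas dZ (Z : measurableType dZ) dU (U : measurableType dU)
  (f : Z -> {fset T} -> U) := pmeas (fun z s => f z (fset_of_seq s)).

Lemma mem_fset_of_seq s x : (x \in fset_of_seq s) = (x \in s).
Proof. by rewrite !inE. Qed.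

Lemma fset_of_seqK (P : {fset T}) : fset_of_seq P = P.
Proof. by apply/fsetP => x; rewrite mem_fset_of_seq. Qed.

Lemma fset_of_seq_cat s1 s2 :
  fset_of_seq (s1 ++ s2) = (fset_of_seq s1 `|` fset_of_seq s2)%fset.
Proof. by apply/fsetP => x; rewrite in_fsetU !mem_fset_of_seq mem_cat. Qed.

Lemma fset_of_seqD1 s x :
  (fset_of_seq s `\ x)%fset = fset_of_seq [seq y <- s | y != x].
Proof. by apply/fsetP => y; rewrite in_fsetD1 !mem_fset_of_seq mem_filter. Qed.

Lemma big_fset_of_seq (R : realType) (s : seq T) (F : T -> \bar R) :
  \sum_(y <- fset_of_seq s) F y = \sum_(y <- undup s) F y.
Proof.
apply: perm_big; apply: uniq_perm; rewrite ?undup_uniq//.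
by move=> x; rewrite mem_fset_of_seq mem_undup.
Qed.

(** The sigma-algebra on configurations is the finest one for which the enumeration maps on tuples
    of every length are measurable. *)
Lemma measurable_configurationP dU (U : measurableType dU) (f : {fset T} -> U) :
  measurable_fun setT f <-> smeas (f \o fset_of_seq).
Proof.
split=> [mf n _ Y mY|mf _ Y mY].
  have : fset_measurable (setT `&` f @^-1` Y) := mf measurableT Y mY.
  by rewrite !setTI => /(_ n).
rewrite setTI; suff : fset_measurable (f @^-1` Y) by [].
by move=> n; have := mf n measurableT Y mY; rewrite setTI.
Qed.

Lemma cmeas_measurable dZ (Z : measurableType dZ) dU (U : measurableType dU)
  (f : Z -> {fset T} -> U) z : cmeas f -> measurable_fun setT (f z).
Proof. by move=> mf; apply/measurable_configurationP; exact: (pmeas_smeas z mf). Qed.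

Lemma measurable_cmeas dZ (Z : measurableType dZ) dU (U : measurableType dU)
  (f : {fset T} -> U) : measurable_fun setT f -> cmeas (fun _ : Z => f).
Proof. by move/measurable_configurationP => mf; exact: (smeas_pmeas mf). Qed.

Lemma cmeas_comp dZ (Z : measurableType dZ) dZ' (Z' : measurableType dZ')
    dU (U : measurableType dU) (f : Z -> {fset T} -> U) (h : Z' -> Z) :
  measurable_fun setT h -> cmeas f -> cmeas (fun z => f (h z)).
Proof. exact: pmeas_comp. Qed.

(** Lets a summand or a predicate depend on the whole configuration being summed or filtered: one
    copy of the sequence is frozen in the parameter during the induction on the length, then
    identified with the running copy. *)
Lemma measurable_diag dZ (Z : measurableType dZ) dU (U : measurableType dU) n
    (f : (Z * n.-tuple T)%type -> seq T -> U) :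
  pmeas f -> measurable_fun [set: (Z * n.-tuple T)%type] (fun p => f p p.2).
Proof.
move=> mf; apply: (measurable_comp_fun (f := fun p => (p, p.2)) (mf n)).
exact: measurable_fun_pair.
Qed.

Hypothesis meq : measurable_fun [set: (T * T)%type] (fun p => p.1 == p.2).

Lemma pmeas_sum_undup (R : realType) dZ (Z : measurableType dZ)
    (g : Z -> T -> \bar R) :
  measurable_fun [set: (Z * T)%type] (fun p => g p.1 p.2) ->
  pmeas (fun z s => \sum_(y <- undup s) g z y).
Proof.
move=> mg n; elim: n dZ Z g mg => [|n IHn] dZ Z g mg.
  rewrite (_ : (fun _ => _) = cst 0)//.
  by apply/funext => -[z q] /=; rewrite (tuple0 q) big_nil.
apply: (measurable_uncons (f := fun z s => \sum_(y <- undup s) g z y)) => /=.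
(* [undup] keeps last occurrences, so the head counts only if it does not recur in the tail. *)
apply: (eq_measurable_fun (fun p : (Z * T) * n.-tuple T =>
   (if has (fun y => y == p.1.2) p.2 then 0 else g p.1.1 p.1.2) +
   \sum_(y <- undup p.2) g p.1.1 y)) => [[[z x] q] _ /=|].
  rewrite has_pred1; case: ifP => _; first by rewrite add0e.
  by rewrite big_cons.
apply: emeasurable_funD; last first.
  apply: (IHn _ (Z * T)%type (fun p => g p.1)).
  apply: (measurable_comp_fun (g := fun p : Z * T => g p.1 p.2)
    (f := fun p : (Z * T) * T => (p.1.1, p.2)) mg).
  by apply: measurable_fun_pair => //; exact: measurableT_comp.
apply: measurable_fun_ifT => //; last exact: (measurable_comp_fun mg).
apply: (pmeas_has (p := fun (p : Z * T) y => y == p.2)).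
apply: (measurable_comp_fun (f := fun p : (Z * T) * T => (p.2, p.1.2)) meq).
by apply: measurable_fun_pair => //; exact: measurableT_comp.
Qed.

Lemma cmeas_sum (R : realType) dZ (Z : measurableType dZ)
    (g : (Z * T)%type -> {fset T} -> \bar R) :
  cmeas g -> cmeas (fun z P => \sum_(y <- P) g (z, y) P).
Proof.
move=> mg n; under eq_fun do rewrite big_fset_of_seq.
apply: (measurable_diag (f := fun (p : Z * n.-tuple T) s =>
  \sum_(y <- undup s) g (p.1, y) (fset_of_seq p.2))).
apply: (pmeas_sum_undup (g := fun (p : Z * n.-tuple T) y =>
  g (p.1, y) (fset_of_seq p.2))).
apply: (measurable_comp_fun (f := fun p : (Z * n.-tuple T) * T =>
  ((p.1.1, p.2), p.1.2)) (mg n)).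
apply: measurable_fun_pair => /=; last exact: measurableT_comp.
by apply: measurable_fun_pair => //; exact: measurableT_comp.
Qed.

Lemma cmeas_filter dZ (Z : measurableType dZ) dU (U : measurableType dU)
    (f : Z -> {fset T} -> U) (p : (Z * T)%type -> {fset T} -> bool) :
  cmeas p -> cmeas f ->
  cmeas (fun z P => f z [fset x in P | p (z, x) P]%fset).
Proof.
move=> mp mf n.
apply: (eq_measurable_fun (fun q : Z * n.-tuple T =>
    f q.1 (fset_of_seq [seq x <- q.2 | p (q.1, x) (fset_of_seq q.2)]))) => [q _|].
  congr (f _ _); apply/fsetP => x.
  by rewrite mem_fset_of_seq mem_filter !inE /= andbC.
apply: (measurable_diag (f := fun (q : Z * n.-tuple T) s =>
  f q.1 (fset_of_seq [seq x <- s | p (q.1, x) (fset_of_seq q.2)]))).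
apply: (pmeas_filter (f := fun (q : Z * n.-tuple T) s => f q.1 (fset_of_seq s))
  (p := fun (q : Z * n.-tuple T) x => p (q.1, x) (fset_of_seq q.2))).
  apply: (measurable_comp_fun (f := fun p : (Z * n.-tuple T) * T =>
    ((p.1.1, p.2), p.1.2)) (mp n)).
  apply: measurable_fun_pair => /=; last exact: measurableT_comp.
  by apply: measurable_fun_pair => //; exact: measurableT_comp.
exact: (pmeas_comp (h := fst) _ mf).
Qed.

Lemma cmeas_has dZ (Z : measurableType dZ) (p : (Z * T)%type -> {fset T} -> bool) :
  cmeas p -> cmeas (fun z P => has (fun x => p (z, x) P) P).
Proof.
move=> mp n.
apply: (eq_measurable_fun (fun q : Z * n.-tuple T =>
    has (fun x => p (q.1, x) (fset_of_seq q.2)) q.2)) => [q _|].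
  by apply: eq_has_r => x; rewrite mem_fset_of_seq.
apply: (measurable_diag (f := fun (q : Z * n.-tuple T) s =>
  has (fun x => p (q.1, x) (fset_of_seq q.2)) s)).
apply: (pmeas_has (p := fun (q : Z * n.-tuple T) x => p (q.1, x) (fset_of_seq q.2))).
apply: (measurable_comp_fun (f := fun p : (Z * n.-tuple T) * T =>
    ((p.1.1, p.2), p.1.2)) (mp n)).
apply: measurable_fun_pair => /=; last exact: measurableT_comp.
by apply: measurable_fun_pair => //; exact: measurableT_comp.
Qed.

Lemma cmeas_D1 dZ (Z : measurableType dZ) dU (U : measurableType dU)
    (f : (Z * T)%type -> {fset T} -> U) :
  cmeas f -> cmeas (fun p P => f p (P `\ p.2)%fset).
Proof.
move=> mf n.
apply: (eq_measurable_fun (fun q : (Z * T) * n.-tuple T =>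
    f q.1 (fset_of_seq [seq x <- q.2 | x != q.1.2]))) => [q _|].
  by rewrite fset_of_seqD1.
apply: (pmeas_filter (f := fun (q : Z * T) s => f q (fset_of_seq s))
  (p := fun (q : Z * T) x => x != q.2)) => //.
apply: measurable_neg.
apply: (measurable_comp_fun (f := fun p : (Z * T) * T => (p.2, p.1.2)) meq).
by apply: measurable_fun_pair => //; exact: measurableT_comp.
Qed.

Lemma cmeas_setU dZ (Z : measurableType dZ) dU (U : measurableType dU)
    (f : Z -> {fset T} -> U) (l : seq T) :
  cmeas f -> cmeas (fun z P => f z (fset_of_seq l `|` P)%fset).
Proof.
move=> mf n.
have := pmeas_comp (h := fun z : Z => (z, in_tuple l)) (pair2_measurable _)
  (pmeas_cat (n := size l) mf).
by move=> /(_ n); apply: eq_measurable_fun => q _; rewrite fset_of_seq_cat.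
Qed.

End configuration_functions.

(** * Integration against Poisson processes *)

Lemma ge0_integral_mrestr d (T : measurableType d) (R : realType)
    (mu : {measure set T -> \bar R}) S (mS : measurable S) (f : T -> \bar R) :
  measurable_fun setT f -> (forall x, 0 <= f x) ->
  \int[mrestr mu mS]_x f x = \int[mu]_(x in S) f x.
Proof.
move=> mf f0; rewrite (@ge0_negligible_integral _ _ _ _ setT (~` S))//; first 1 last.
- exact: measurableC.
- by rewrite /= /mrestr setICl measure0.
rewrite setTD setCK; apply: eq_measure_integral => A mA AS.
by rewrite /= /mrestr (setIidl AS).
Qed.

Lemma integral_poisson_prob (R : realType) (rate : R) (g : nat -> \bar R) :
  0 < rate%:E -> (forall k, 0 <= g k) ->
  \int[poisson_prob rate 0]_k g k = \sum_(k <oo) (poisson_pmf rate k)%:E * g k.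
Proof.
rewrite lte_fin => rate0 g0.
have -> : [set: nat] = \bigcup_k [set k].
  by apply/seteqP; split => // k _; exists k.
rewrite ge0_integral_bigcup//; last first.
  by apply/trivIsetP => i j _ _ ij; apply/seteqP; split => // k [/= -> /eqP]; rewrite (negbTE ij).
apply: eq_eseriesr => k _.
rewrite (eq_integral (cst (g k))) => [|x]; last by rewrite inE => ->.
rewrite integral_cst//= /poisson_prob rate0 esum_set1 1?muleC//.
by rewrite lee_fin poisson_pmf_ge0.
Qed.

Section power_measure_probability.
Context d (T : measurableType d) (R : realType) (P : probability T R) (n : nat).

(** A separate name on which the probability structure is declared, as the Giry monad requires. *)
Definition power_measure_probability := (power_measure P n : set _ -> \bar R).

HB.instance Definition _ := Measure.on power_measure_probability.

HB.instance Definition _ := Measure_isProbability.Build _ _ _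
  power_measure_probability (power_measure_setT P n).

End power_measure_probability.

Section poisson_integral.
Context d (T : measurableType d) (R : realType).
Variables (mu : {sigma_finite_measure set T -> \bar R}) (a : R).
Hypothesis a0 : (0 <= a)%R.
Implicit Types (S : set T) (phi psi : seq T -> \bar R).

(* The expectation of [phi] at an enumeration of a Poisson process on [S]. *)
Definition pois_int S phi : \bar R :=
  (expR (- (a * fine (mu S))))%:E *
  \sum_(k <oo) (a ^+ k / k`!%:R)%:E * iint mu S k phi.

Let coef0 k : (0 <= (a ^+ k / k`!%:R)%:E :> \bar R).
Proof. by rewrite lee_fin divr_ge0// exprn_ge0. Qed.

Let term0 S phi k : (forall s, 0 <= phi s) ->
  0 <= (a ^+ k / k`!%:R)%:E * iint mu S k phi.
Proof. by move=> phi0; rewrite mule_ge0// iint_ge0. Qed.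

Lemma pois_int_ge0 S phi : (forall s, 0 <= phi s) -> 0 <= pois_int S phi.
Proof.
move=> phi0; rewrite mule_ge0 ?lee_fin ?expR_ge0//.
by apply: nneseries_ge0 => k _ _; exact: term0.
Qed.

Lemma pois_intD S phi psi : measurable S -> smeas phi -> smeas psi ->
  (forall s, 0 <= phi s) -> (forall s, 0 <= psi s) ->
  pois_int S (fun s => phi s + psi s) = pois_int S phi + pois_int S psi.
Proof.
move=> mS mphi mpsi phi0 psi0; rewrite /pois_int -ge0_muleDr.
- congr (_ * _); rewrite -nneseriesD; [|by move=> *; exact: term0..].
  by apply: eq_eseriesr => k _; rewrite iintD// ge0_muleDr// iint_ge0.
- by apply: nneseries_ge0 => k _ _; exact: term0.
- by apply: nneseries_ge0 => k _ _; exact: term0.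
Qed.

Lemma measurable_pois_int dZ (Z : measurableType dZ) (S : Z -> set T)
    (phi : Z -> seq T -> \bar R) :
  measurable [set p : (Z * T)%type | S p.1 p.2] ->
  pmeas phi -> (forall z s, 0 <= phi z s) ->
  measurable_fun setT (fun z => pois_int (S z) (phi z)).
Proof.
move=> mS mphi phi0; apply: emeasurable_funM.
  apply/measurable_EFinP; apply: measurableT_comp => //.
  apply: measurableT_comp => //; apply: measurable_funM => //.
  apply: measurableT_comp => //.
  apply: (eq_measurable_fun (fun z => \int[mu]_(x in S z) cst 1 x)).
    move=> z _; rewrite integral_cst ?mul1e//; exact: (measurable_section z mS).
  exact: (measurable_section_integral (g := fun _ _ => 1) mu mS).
apply: (ge0_emeasurable_sum (P := xpredT)) => k.
  by move=> z _ _; exact: term0.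
by move=> _; apply: measurable_funeM; exact: measurable_iint.
Qed.

Lemma pois_int_integral S dZ (Z : measurableType dZ)
    (nu : {sigma_finite_measure set Z -> \bar R}) (D : set Z)
    (phi : Z -> seq T -> \bar R) :
  measurable S -> measurable D -> pmeas phi -> (forall z s, 0 <= phi z s) ->
  pois_int S (fun s => \int[nu]_(z in D) phi z s) =
  \int[nu]_(z in D) pois_int S (phi z).
Proof.
move=> mS mD mphi phi0.
have mi k : measurable_fun D (fun z => iint mu S k (phi z)).
  apply: measurable_funTS; apply: (@measurable_iint _ _ _ _ _ _ (fun=> S)) => //.
  exact: measurable_const_section.
rewrite /pois_int ge0_integralZl ?lee_fin ?expR_ge0//; last 2 first.
- apply: (ge0_emeasurable_sum (P := xpredT)) => k.
    by move=> z _ _; exact: term0.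
  by move=> _; apply: measurable_funeM.
- by move=> z _; apply: nneseries_ge0 => k _ _; exact: term0.
congr (_ * _); rewrite integral_nneseries//; last 2 first.
- by move=> k; exact: measurable_funeM.
- by move=> k z _; exact: term0.
apply: eq_eseriesr => k _; rewrite iint_integral// ge0_integralZl//.
by move=> z _; exact: iint_ge0.
Qed.

Lemma power_measure_integral (nu : {sigma_finite_measure set T -> \bar R}) n phi :
  smeas phi -> (forall s, 0 <= phi s) ->
  \int[power_measure nu n]_q phi (tval q) = iint nu setT n phi.
Proof.
elim: n phi => [|n IHn] phi mphi phi0 /=.
  by rewrite integral_dirac ?diracT ?mul1e//; exact: (mphi 0%N).
pose psi (p : T * n.-tuple T) := phi (p.1 :: p.2).
have mpsi : measurable_fun setT psi by exact: (smeas_cons mphi).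
transitivity (\int[pushforward (nu \x power_measure nu n) (@tcons _ T n)]_q phi (tval q)).
  by [].
rewrite ge0_integral_pushforward//; [|exact: measurable_tcons|exact: (mphi n.+1)].
rewrite preimage_setT (@fubini_tonelli1 _ _ _ _ _ _ _ psi)//; last first.
  by move=> p; exact: phi0.
by apply: eq_integral => x _; rewrite -IHn//; exact: smeas_head.
Qed.

Lemma uniform_on_integral S (mS : measurable S) (f : T -> \bar R) :
  0 < mu S < +oo -> measurable_fun setT f -> (forall x, 0 <= f x) ->
  \int[uniform_on mu mS]_x f x = (fine (mu S))^-1%:E * \int[mu]_(x in S) f x.
Proof.
move=> /andP[m0 moo] mf f0.
have c0 : (0 <= (fine (mu S))^-1)%R by rewrite invr_ge0 fine_ge0.
rewrite -(@ge0_integral_mrestr _ _ _ mu S mS)// -[in RHS](@ge0_integral_mscale _ _ _ _ _ measurableT (NngNum c0))//.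
apply: eq_measure_integral => A mA _.
rewrite /= /uniform_on/= /mnormalize /= /mrestr setTI gt_eqF//= lt_eqF//=.
by rewrite /mscale/= muleC.
Qed.

Lemma uniform_on_iint S (mS : measurable S) k phi :
  0 < mu S < +oo -> smeas phi -> (forall s, 0 <= phi s) ->
  iint (uniform_on mu mS) setT k phi =
  ((fine (mu S))^-1 ^+ k)%:E * iint mu S k phi.
Proof.
move=> m0; elim: k phi => [|k IHk] phi mphi phi0 /=; first by rewrite mul1e.
have c0 : (0 <= (fine (mu S))^-1)%R by rewrite invr_ge0 fine_ge0.
have mi := measurable_iint_cons mu k mS mphi phi0.
transitivity (\int[uniform_on mu mS]_x (((fine (mu S))^-1 ^+ k)%:E *
    iint mu S k (fun s => phi (x :: s)))).
  by apply: eq_integral => x _; apply: IHk => //; exact: smeas_head.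
rewrite ge0_integralZl ?lee_fin ?exprn_ge0//; last first.
  by move=> x _; exact: iint_ge0.
rewrite uniform_on_integral//; last by move=> x; exact: iint_ge0.
by rewrite muleA -EFinM exprSr.
Qed.

Lemma iint_null S k phi : measurable S -> smeas phi -> (forall s, 0 <= phi s) ->
  mu S = 0 -> iint mu S k.+1 phi = 0.
Proof.
move=> mS mphi phi0 S0 /=.
rewrite (@ge0_negligible_integral _ _ _ _ S S)// ?setDv ?integral_set0//.
  by apply: measurable_funTS; exact: measurable_iint_cons.
by move=> x _; exact: iint_ge0.
Qed.

Lemma measurable_fset_of_tuple k : measurable_fun setT (@fset_of_tuple _ T k).
Proof. by move=> _ A mA; rewrite setTI; exact: mA. Qed.

(** The normalisations cancel: [k] uniform points contribute the factor [(mu S)^-k], the Poisson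
    weight contributes [(a mu S)^k / k!]. *)
Lemma poisson_process_integral S (mS : measurable S) (f : {fset T} -> \bar R) :
  mu S < +oo -> measurable_fun setT f -> (forall P, 0 <= f P) ->
  \int[poisson_process mu a mS]_P f P = pois_int S (fun s => f (fset_of_seq s)).
Proof.
move=> Soo mf f0; pose phi s := f (fset_of_seq s); rewrite -/phi.
have mphi : smeas phi by exact/measurable_configurationP.
have phi0 s : 0 <= phi s by exact: f0.
pose nu k : giry {fset T} R := giry_map (@measurable_fset_of_tuple k)
  (power_measure_probability (uniform_on mu mS) (n := k)).
have nuf k : \int[nu k]_P f P = iint (uniform_on mu mS) setT k phi.
  rewrite -power_measure_integral//.
  by rewrite [LHS]giry_int_map.
rewrite (@integral_mixture _ _ _ _ _ (poisson_prob (a * fine (mu S)) 0) nu)//.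
under eq_integral do rewrite nuf.
(* At rate zero the number of points is a Dirac mass at 0. Then either [a] or [mu S] vanishes, and
   each of the two kills every term of positive length. *)
have [am0|am0] := ltP 0%R (a * fine (mu S))%R; last first.
  have am : (a * fine (mu S) = 0)%R by apply/le_anti; rewrite am0 mulr_ge0// fine_ge0.
  rewrite (eq_measure_integral (\d_0%N)) => [|A mA _]; last first.
    by rewrite /= /poisson_prob ltNge am0.
  rewrite integral_dirac// diracT mul1e /pois_int am oppr0 expR0 mul1e.
  rewrite nneseries_recl//; last by move=> k _; exact: term0.
  rewrite divr1 expr0 mul1e eseries0 ?adde0// => -[//|k] _ _.
  have [->|a00] := eqVneq a 0%R; first by rewrite expr0n mul0r mul0e.
  rewrite iint_null ?mule0//; move/eqP : am; rewrite mulf_eq0 (negbTE a00)/=.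
  by rewrite fine_eq0 ?ge0_fin_numE// => /eqP.
have m0 : 0 < mu S < +oo.
  rewrite Soo andbT lt0e measure_ge0 andbT; apply: contraTneq am0 => ->.
  by rewrite mulr0 ltxx.
rewrite integral_poisson_prob ?lte_fin//; last by move=> k; exact: iint_ge0.
rewrite /pois_int -nneseriesZl; last by move=> k _; exact: term0.
apply: eq_eseriesr => k _; rewrite uniform_on_iint// !muleA -!EFinM; congr (_%:E * _).
rewrite /poisson_pmf am0 exprMn.
have mk : (fine (mu S) ^+ k != 0)%R.
  by rewrite expf_neq0// fine_eq0 ?ge0_fin_numE// gt_eqF//; case/andP: m0.
by rewrite exprVn; field; rewrite mk pnatr_eq0 -lt0n fact_gt0.
Qed.

End poisson_integral.

(** * Mecke's and Campbell's formulas for Poisson processes *)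

Section mecke.
Context d (T : measurableType d) (R : realType).
Variables (mu : {sigma_finite_measure set T -> \bar R}) (a : R).
Hypothesis a0 : (0 <= a)%R.
Hypothesis meq : measurable_fun [set: (T * T)%type] (fun p => p.1 == p.2).
Hypothesis mu1 : forall x, measurable [set x] /\ mu [set x] = 0.
Implicit Types (S : set T) (phi psi : seq T -> \bar R).

Let coef0 k : (0 <= (a ^+ k / k`!%:R)%:E :> \bar R).
Proof. by rewrite lee_fin divr_ge0// exprn_ge0. Qed.

Let term0 S phi k : (forall s, 0 <= phi s) ->
  0 <= (a ^+ k / k`!%:R)%:E * iint mu S k phi.
Proof. by move=> phi0; rewrite mule_ge0// iint_ge0. Qed.

Lemma le_pois_int S phi psi : measurable S -> smeas phi -> smeas psi ->
    (forall s, 0 <= phi s) -> (forall s, 0 <= psi s) ->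
    (forall s, uniq s -> (forall x, x \in s -> S x) -> phi s <= psi s) ->
  pois_int mu a S phi <= pois_int mu a S psi.
Proof.
move=> mS mphi mpsi phi0 psi0 h.
rewrite /pois_int lee_wpmul2l ?lee_fin ?expR_ge0//.
apply: lee_nneseries => [k _ _|k _]; first exact: term0.
rewrite lee_wpmul2l//; apply: (@le_iint _ _ _ _ mu1 _ _ [::]) => //.
by move=> s us hs; apply: h => // x /hs[].
Qed.

(* The sum of [Phi x u] over all ways of removing one entry [x] from [s], leaving [u]. *)
Fixpoint rsum (Phi : T -> seq T -> \bar R) s : \bar R :=
  if s is x :: s' then Phi x s' + rsum (fun y u => Phi y (x :: u)) s' else 0.

Lemma rsum_ge0 Phi s : (forall y u, 0 <= Phi y u) -> 0 <= rsum Phi s.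
Proof.
elim: s Phi => [|x s IHs] Phi Phi0 //=.
by rewrite adde_ge0// IHs.
Qed.

Lemma pmeas_rsum dZ (Z : measurableType dZ) (Phi : Z -> T -> seq T -> \bar R) :
  pmeas (fun p : (Z * T)%type => Phi p.1 p.2) -> pmeas (fun z => rsum (Phi z)).
Proof.
move=> mPhi n; elim: n dZ Z Phi mPhi => [|n IHn] dZ Z Phi mPhi.
  rewrite (_ : (fun _ => _) = cst 0)//.
  by apply/funext => -[z q] /=; rewrite (tuple0 q).
apply: (measurable_uncons (f := fun z => rsum (Phi z))) => /=.
apply: emeasurable_funD; first exact: (mPhi n).
apply: (IHn _ (Z * T)%type (fun p y u => Phi p.1 y (p.2 :: u))).
have mh : measurable_fun setT (fun q : (Z * T) * T => ((q.1.1, q.2), q.1.2)).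
  apply: measurable_fun_pair => /=; last exact: measurableT_comp.
  by apply: measurable_fun_pair => //; exact: measurableT_comp.
exact: (pmeas_comp mh (pmeas_cons mPhi)).
Qed.

Lemma smeas_rsum Phi : pmeas Phi -> smeas (rsum Phi).
Proof.
move=> mPhi; apply: (pmeas_smeas (f := fun _ : unit => rsum Phi) tt).
by apply: pmeas_rsum; exact: pmeas_comp.
Qed.

(** Each of the [k.+1] positions of the removed entry contributes the same integral. Removal of the
    head gives it directly; for removals from the tail, the induction hypothesis is followed by an
    exchange of the head with the removed entry. *)
Lemma iint_rsum S k Phi : measurable S -> pmeas Phi -> (forall y s, 0 <= Phi y s) ->
  iint mu S k.+1 (rsum Phi) = k.+1%:R%:E * \int[mu]_(y in S) iint mu S k (Phi y).
Proof.
move=> mS; elim: k Phi => [|k IHk] Phi mPhi Phi0.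
  by rewrite mul1e /=; apply: eq_integral => x _; rewrite adde0.
have mPhix x : pmeas (fun y u => Phi y (x :: u)).
  exact: (pmeas_comp (h := fun y => (y, x)) (pair2_measurable x) (pmeas_cons mPhi)).
have mi j : measurable_fun S (fun y => iint mu S j (Phi y)).
  apply: measurable_funTS; apply: (@measurable_iint _ _ _ _ _ _ (fun=> S)) => //.
  exact: measurable_const_section.
pose psi s := \int[mu]_(y in S) Phi y s.
have mpsi : smeas psi.
  apply: (pmeas_smeas (f := fun _ : unit => psi) tt) => n.
  apply: (@measurable_section_integral _ _ _ _ _ (unit * n.-tuple T)%type (fun=> S)
    (fun p y => Phi y p.2)) => //; first exact: measurable_const_section.
  have mh : measurable_fun setT (fun q : (unit * n.-tuple T) * T => (q.2, q.1.2)).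
    by apply: measurable_fun_pair => //=; exact: measurableT_comp.
  exact: (measurable_comp_fun (mPhi n) mh).
have psi0 s : 0 <= psi s by exact: integral_ge0.
transitivity (\int[mu]_(x in S) (iint mu S k.+1 (Phi x) +
    k.+1%:R%:E * iint mu S k (fun u => psi (x :: u)))).
  apply: eq_integral => x _.
  transitivity (iint mu S k.+1 (fun s => Phi x s + rsum (fun y u => Phi y (x :: u)) s)).
    by [].
  rewrite iintD//; [|exact: (pmeas_smeas x mPhi)|exact: smeas_rsum|by move=> s; exact: rsum_ge0].
  by rewrite IHk// -iint_integral.
rewrite ge0_integralD//; last 3 first.
- by move=> x _; exact: iint_ge0.
- by move=> x _; rewrite mule_ge0 ?lee_fin// iint_ge0.
- apply: measurable_funeM; apply: measurable_funTS; exact: measurable_iint_cons.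
rewrite ge0_integralZl ?lee_fin//; last 2 first.
- by apply: measurable_funTS; exact: measurable_iint_cons.
- by move=> x _; exact: iint_ge0.
rewrite [X in _ + _ * X](_ : _ = \int[mu]_(y in S) iint mu S k.+1 (Phi y)); last first.
  by rewrite -(@iint_integral _ _ _ _ S k.+1).
by rewrite -[X in X + _]mul1e -ge0_muleDl ?lee_fin// -EFinD nat1r.
Qed.

(** Without repetitions, removing an entry is the same as removing a point. The set [A] collects the
    entries that the induction has already passed. *)
Lemma rsum_fset (F : T -> {fset T} -> \bar R) (A : {fset T}) s :
  uniq s -> (forall x, x \in s -> x \notin A) ->
  rsum (fun y u => F y (A `|` fset_of_seq u)%fset) s =
  \sum_(y <- s) F y ((A `|` fset_of_seq s) `\ y)%fset.
Proof.
elim: s A => [|x s IHs] A /=; first by rewrite big_nil.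
move=> /andP[xs us] sA; rewrite big_cons; congr +%E.
  congr (F x _); apply/fsetP => y; rewrite !(in_fsetD1, in_fsetU, mem_fset_of_seq) inE.
  case: eqVneq => //= ->; rewrite (negbTE xs) orbF; apply/negbTE/sA.
  by rewrite inE eqxx.
have E u : (A `|` fset_of_seq (x :: u) = (x |` A) `|` fset_of_seq u)%fset.
  apply/fsetP => y; rewrite !(in_fset1U, in_fsetU, mem_fset_of_seq) inE.
  by case: (y == x); case: (y \in A).
under eq_fun do under eq_fun do rewrite E.
rewrite IHs//; first by under [RHS]eq_bigr do rewrite E.
move=> y ys; rewrite in_fset1U negb_or sA ?inE ?ys ?orbT// andbT.
by apply: contraNneq xs => <-.
Qed.

(** The factor [k.+1] of [iint_rsum] turns [a^(k+1) / (k+1)!] into [a] times [a^k / k!], so the term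
    of length [k.+1] on the left matches the one of length [k] on the right. Replacing the sum over
    the set by [rsum] changes nothing almost surely. *)
Lemma mecke S (F : T -> {fset T} -> \bar R) : measurable S -> mu S < +oo ->
  cmeas F -> (forall y P, 0 <= F y P) ->
  pois_int mu a S (fun s => \sum_(y <- fset_of_seq s) F y (fset_of_seq s `\ y)%fset) =
  a%:E * \int[mu]_(y in S) pois_int mu a S (fun s => F y (fset_of_seq s)).
Proof.
move=> mS Soo mF F0.
pose Phi y s := F y (fset_of_seq s).
have mPhi : pmeas Phi by exact: mF.
have Phi0 y s : 0 <= Phi y s by exact: F0.
set phi := fun s : seq T => \sum_(y <- _) _.
have mphi : smeas phi.
  have := cmeas_sum meq (g := fun (p : unit * T) P => F p.2 (P `\ p.2)%fset).
  move=> /(_ _)/(pmeas_smeas tt); apply.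
  apply: (cmeas_D1 meq (f := fun (p : unit * T) P => F p.2 P)).
  exact: (cmeas_comp (h := snd) _ mF).
have phi0 s : 0 <= phi s by apply: sume_ge0 => y _; exact: F0.
have phiE s : uniq s -> phi s = rsum Phi s.
  move=> us; have := @rsum_fset F fset0 s us (fun _ _ => erefl).
  under eq_fun do under eq_fun do rewrite fset0U.
  by rewrite fset0U => ->; rewrite /phi big_fset_of_seq undup_id.
have mr := smeas_rsum mPhi.
have r0 s : 0 <= rsum Phi s by exact: rsum_ge0.
transitivity (pois_int mu a S (rsum Phi)).
  by apply/le_anti/andP; split; apply: le_pois_int => // s us _; rewrite phiE.
have mpi : measurable_fun S (fun y => pois_int mu a S (Phi y)).
  apply: measurable_funTS; apply: (@measurable_pois_int _ _ _ _ _ a0 _ _ (fun=> S)) => //.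
  exact: measurable_const_section.
pose J k := \int[mu]_(y in S) iint mu S k (Phi y).
have mi k : measurable_fun S (fun y => iint mu S k (Phi y)).
  apply: measurable_funTS; apply: (@measurable_iint _ _ _ _ _ _ (fun=> S)) => //.
  exact: measurable_const_section.
have J0 k : 0 <= J k by apply: integral_ge0 => y _; exact: iint_ge0.
rewrite /pois_int ge0_integralZl ?lee_fin ?expR_ge0//; last 2 first.
- apply: (ge0_emeasurable_sum (P := xpredT)) => k.
    by move=> z _ _; exact: term0.
  by move=> _; apply: measurable_funeM.
- by move=> z _; apply: nneseries_ge0 => k _ _; exact: term0.
rewrite muleCA; congr (_ * _).
rewrite integral_nneseries//; last 2 first.
- by move=> k; exact: measurable_funeM.
- by move=> k z _; exact: term0.
(* The empty configuration contributes zero to the left-hand side, so its series may start at 1 and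
   be shifted. *)
rewrite nneseries_recl//; last by move=> k _; exact: term0.
rewrite [X in X + _](_ : _ = 0) ?add0e; last by rewrite /= mule0.
rewrite -nneseriesZl; last by move=> k _; apply: integral_ge0 => y _; exact: term0.
rewrite -nneseries_addn//; last by move=> k; exact: term0.
apply: eq_eseriesr => k _; rewrite addn1 iint_rsum// -/(J k).
rewrite ge0_integralZl//; last by move=> y _; exact: iint_ge0.
rewrite -/(J k) !muleA -!EFinM; congr (_%:E * _).
rewrite exprS factS natrM; field.
by rewrite nat1r !pnatr_eq0 -lt0n fact_gt0.
Qed.

Lemma pois_int_cst S c : measurable S -> mu S < +oo -> 0 <= c ->
  pois_int mu a S (fun=> c) = c.
Proof.
move=> mS Soo c0; rewrite -(poisson_process_integral a0 mS (f := fun=> c))//.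
rewrite [LHS](@integral_cst _ _ _ _ setT measurableT c).
by rewrite [X in c * X]probability_setT mule1.
Qed.

(** Campbell's formula: Mecke's formula for a functional that ignores the configuration. *)
Lemma pois_int_sum S (g : T -> \bar R) : measurable S -> mu S < +oo ->
  measurable_fun setT g -> (forall y, 0 <= g y) ->
  pois_int mu a S (fun s => \sum_(y <- fset_of_seq s) g y) =
  a%:E * \int[mu]_(y in S) g y.
Proof.
move=> mS Soo mg g0; rewrite (mecke (F := fun y _ => g y))//; last first.
  by move=> n; exact: (measurable_comp_fun mg).
by congr (_ * _); apply: eq_integral => y _; rewrite pois_int_cst.
Qed.

End mecke.

(** * Bad points and resampling sets *)

Lemma card_fset_filter (T : choiceType) (p : pred T) (P : {fset T}) :
  #|` [fset x in P | p x]%fset| = count p P.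
Proof.
rewrite -size_filter; apply: perm_size; apply: uniq_perm => //.
  by rewrite filter_uniq.
by move=> x; rewrite mem_filter !inE /= andbC.
Qed.

Lemma leq_has_count (T : eqType) (p : pred T) (s : seq T) : (has p s <= count p s)%N.
Proof. by rewrite has_count; case: (count p s). Qed.


Section bad_points_theory.
Context (R : realType) (d : nat) (r : R).
Local Notation E := (euclid R d).
Implicit Types (P Q : {fset E}) (x y z : E).

Lemma edistC x y : edist x y = edist y x.
Proof.
rewrite /edist /enorm; congr Num.sqrt; apply: eq_bigr => i _.
by rewrite !tnth_mktuple -[RHS]sqrrN opprB.
Qed.

Definition nearby x y := (edist x y < 2 * r)%R.
Definition conflict x y := (x != y) && nearby x y.

Lemma nearbyC x y : nearby x y = nearby y x.
Proof. by rewrite /nearby edistC. Qed.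

Lemma conflictC x y : conflict x y = conflict y x.
Proof. by rewrite /conflict eq_sym nearbyC. Qed.

Lemma mem_bad_points P y : (y \in bad_points r P) = (y \in P) && has (conflict y) P.
Proof.
apply/bigfcupP/andP => [[e /andP[+ _]]|[yP /hasP[x xP xy]]].
  move=> /imfset2P[u uP [v]]; rewrite inE => /andP[/= vP uv] ->.
  rewrite !inE => /orP[/eqP->|/eqP->]; split => //; apply/hasP.
    by exists v.
  by exists u => //; rewrite conflictC.
exists [fset y; x]%fset; last by rewrite !inE eqxx.
by rewrite andbT; apply/imfset2P; exists y => //; exists x => //; rewrite inE xP.
Qed.

Definition good P : {fset E} := (P `\` bad_points r P)%fset.

Lemma goodE P : good P = [fset x in P | ~~ has (conflict x) P]%fset.
Proof.
apply/fsetP => y; rewrite in_fsetD mem_bad_points !inE /= negb_and.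
by case: (y \in P) => //=; rewrite andbT.
Qed.

Lemma mem_good P y : (y \in good P) = (y \in P) && ~~ has (conflict y) P.
Proof. by rewrite goodE !inE. Qed.

(** Boolean form of the resampling set, written with [has] so that joint measurability in the point
    and the configuration can be read off. *)
Definition in_resampling P z :=
  has (fun x => has (conflict x) P && nearby z x) P && `[< cube R d z >].

Lemma resampling_setP P z : resampling_set r P z <-> in_resampling P z.
Proof.
split=> [[[x /=]]|/andP[/hasP[x xP /andP[xb zx]] /asboolP cz]].
  rewrite mem_bad_points => /andP[xP xb] zx cz; apply/andP; split; last exact/asboolP.
  by apply/hasP; exists x => //; rewrite xb.
by split => //; exists x => //=; rewrite mem_bad_points xP.
Qed.

(** A point of [P] within [2 * r] of a bad point either is that point or conflicts with it; in both
    cases it is bad. *)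
Lemma good_notin_resampling P y : y \in good P -> ~~ in_resampling P y.
Proof.
rewrite mem_good => /andP[yP yg]; rewrite negb_and; apply/orP; left.
apply/hasP => -[x xP /andP[xb yx]]; move/negP : yg; apply.
have [xy|xy] := eqVneq x y; first by rewrite -xy.
by apply/hasP; exists x => //; rewrite /conflict eq_sym xy.
Qed.

(** A good point conflicts with no point of [P], so deleting it destroys no conflict. The next two
    lemmas carry this over to the good part and to the resampling set. *)
Lemma has_conflict_fsetD1 P x y : y \in good P -> x \in P ->
  has (conflict x) (P `\ y)%fset = has (conflict x) P.
Proof.
rewrite mem_good => /andP[yP /hasPn yg] xP.
apply/hasP/hasP => -[z]; first by rewrite in_fsetD1 => /andP[_ zP] xz; exists z.
move=> zP xz; exists z => //; rewrite in_fsetD1 zP andbT.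
by apply: contraTneq xz => ->; rewrite conflictC yg.
Qed.

Lemma good_fsetD1 P y : y \in good P -> good (P `\ y)%fset = (good P `\ y)%fset.
Proof.
move=> yg; apply/fsetP => x; rewrite in_fsetD1 !mem_good in_fsetD1.
case: eqVneq => //= xy; case: (boolP (x \in P)) => //= xP.
by rewrite has_conflict_fsetD1.
Qed.

Lemma in_resampling_fsetD1 P y z : y \in good P ->
  in_resampling (P `\ y)%fset z = in_resampling P z.
Proof.
move=> yg; congr (_ && _); apply/hasP/hasP => -[x].
  rewrite in_fsetD1 => /andP[xy xP]; rewrite has_conflict_fsetD1// => h.
  by exists x.
move=> xP h; exists x; last by rewrite has_conflict_fsetD1.
rewrite in_fsetD1 xP andbT; apply: contraTneq h => ->.
by move: yg; rewrite mem_good => /andP[_ /negbTE ->].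
Qed.

Lemma card_bad_points P : #|` bad_points r P| = count (fun x => has (conflict x) P) P.
Proof.
rewrite -card_fset_filter; congr #|` _|; apply/fsetP => x.
by rewrite mem_bad_points !inE.
Qed.

Lemma has_conflict_le P x :
  (has (conflict x) P <= count (nearby x) (P `\ x)%fset)%N.
Proof.
rewrite (_ : has _ _ = has (nearby x) (P `\ x)%fset) ?leq_has_count//.
apply/hasP/hasP => -[y].
  by move=> yP /andP[xy cy]; exists y => //; rewrite in_fsetD1 eq_sym xy.
by rewrite in_fsetD1 => /andP[yx yP] cy; exists y => //; rewrite /conflict eq_sym yx.
Qed.

(** A bad point has at least one near neighbour. The sum over ordered pairs has the form whose mean
    Mecke's formula computes. *)
Lemma card_bad_points_le P :
  (#|` bad_points r P| <= \sum_(x <- P) count (nearby x) (P `\ x)%fset)%N.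
Proof.
rewrite card_bad_points -sum1_count big_mkcond/=; apply: leq_sum => x _.
by case: ifPn (has_conflict_le P x).
Qed.

Lemma sum_countC P Q :
  (\sum_(x <- P) count (nearby x) Q = \sum_(x <- Q) count (nearby x) P)%N.
Proof.
under eq_bigr do rewrite -sum1_count big_mkcond/=.
rewrite exchange_big/=; apply: eq_bigr => x _.
rewrite -sum1_count [RHS]big_mkcond/=; apply: eq_bigr => y _.
by rewrite nearbyC.
Qed.

(* After resampling, every bad pair has a point among the new ones. *)
Lemma card_bad_points_step P Q :
  (#|` bad_points r (good P `|` Q)%fset| <=
   \sum_(x <- Q) count (nearby x) (Q `\ x)%fset +
   (\sum_(x <- Q) count (nearby x) (good P)).*2)%N.
Proof.
set P' := (good P `|` Q)%fset.
have hU x : has (conflict x) P' = has (conflict x) (good P) || has (conflict x) Q.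
  apply/hasP/orP => [[y]|[/hasP[y yP xy]|/hasP[y yP xy]]].
  - by rewrite in_fsetU => /orP[yP|yP] xy; [left|right]; apply/hasP; exists y.
  - by exists y => //; rewrite in_fsetU yP.
  - by exists y => //; rewrite in_fsetU yP orbT.
have le_conflict x A : (has (conflict x) A <= count (nearby x) A)%N.
  by apply: leq_trans (leq_has_count _ _) (sub_count _ _) => y /andP[].
(* Good points of [P] have no conflict among themselves, so one that becomes bad has a neighbour in
   [Q]. *)
have near_good x : x \in good P -> (has (conflict x) P' <= count (nearby x) Q)%N.
  move=> xg; rewrite hU (_ : has _ (good P) = false) //=.
  apply/negP => /hasP[y]; rewrite mem_good => /andP[yP _] xy.
  by move: xg; rewrite mem_good => /andP[_ /hasPn/(_ y yP)]; rewrite xy.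
have near_new x : (has (conflict x) P' <=
    count (nearby x) (Q `\ x)%fset + count (nearby x) (good P))%N.
  rewrite hU addnC; apply: leq_trans (leq_add (le_conflict x _) (has_conflict_le Q x)).
  by case: (has _ (good P)); case: (has _ Q).
rewrite card_bad_points -card_fset_filter.
rewrite (_ : [fset x in P' | _]%fset =
    [fset x in good P | has (conflict x) P'] `|` [fset x in Q | has (conflict x) P'])%fset; last first.
  by apply/fsetP => x; rewrite !inE /= andb_orl.
rewrite cardfsU (leq_trans (leq_subr _ _))// !card_fset_filter addnC.
rewrite -addnn addnA; apply: leq_add.
  rewrite -sum1_count big_mkcond -big_split/=; apply: leq_sum => x _.
  by case: ifP (near_new x).
(* The mixed pairs are counted again, this time from their good endpoints; this is the source of the
   doubling. *)
rewrite sum_countC -sum1_count big_mkcond/= !big_seq; apply: leq_sum => x xg.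
by case: ifP (near_good x xg).
Qed.

End bad_points_theory.

(** * One pass through the loop as a transition kernel *)

Section resampling_kernel.
Context (R : realType) (d : nat) (lambda r : R).
Local Notation E := (euclid R d).
Local Notation a := (intensity d lambda r).
Local Notation mu := (volume R d).
Implicit Types (P Q : {fset E}) (x y z : E) (f : {fset E} -> \bar R).

(** The diagonal is the zero set of the measurable function [edist]. *)
Lemma measurable_eq_euclid : measurable_fun [set: (E * E)%type] (fun p => p.1 == p.2).
Proof.
apply: (eq_measurable_fun (fun p : E * E => edist p.1 p.2 == 0%R)) => [p _|].
  by rewrite edist_eq0.
apply: measurable_fun_eqr => //.
by apply: measurable_edist; [exact: measurable_fst|exact: measurable_snd].
Qed.
Local Notation meq := measurable_eq_euclid.

Lemma measurable_nearby : measurable_fun [set: (E * E)%type] (fun p => nearby r p.1 p.2).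
Proof.
apply: measurable_fun_ltr => //.
by apply: measurable_edist; [exact: measurable_fst|exact: measurable_snd].
Qed.

Lemma cmeas_param dZ (Z : measurableType dZ) dU (U : measurableType dU) (g : Z -> U) :
  measurable_fun setT g -> cmeas (fun v (_ : {fset E}) => g v).
Proof. by move=> mg n; exact: (measurable_comp_fun mg). Qed.

Lemma cmeas_conflict : cmeas (fun x P => has (conflict r x) P).
Proof.
apply: (cmeas_has (p := fun q P => conflict r q.1 q.2)).
apply: (cmeas_param (g := fun q => conflict r q.1 q.2)).
apply: measurable_and; last exact: measurable_nearby.
by apply: measurable_neg; exact: meq.
Qed.

Lemma cmeas_in_resampling : cmeas (fun z P => in_resampling r P z).
Proof.
move=> n; apply: measurable_and.
  apply: (cmeas_has (p := fun q P => has (conflict r q.2) P && nearby r q.1 q.2)) => m.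
  apply: measurable_and.
    exact: (cmeas_comp (h := snd) _ cmeas_conflict).
  exact: (measurable_comp_fun measurable_nearby).
apply: (measurable_comp_fun (g := fun z : E => `[< cube R d z >])) => //.
apply: (measurable_fun_bool true); rewrite setTI.
rewrite (_ : _ @^-1` _ = cube R d); first exact: measurable_cube.
by apply/seteqP; split => z /= /asboolP.
Qed.

Lemma measurable_resampling_graph dZ (Z : measurableType dZ) n :
  measurable [set p : ((Z * n.-tuple E) * E)%type |
    resampling_set r (fset_of_seq p.1.2) p.2].
Proof.
rewrite (_ : [set _ | _] = (fun p : (Z * n.-tuple E) * E =>
    in_resampling r (fset_of_seq p.1.2) p.2) @^-1` [set true]).
  have mh : measurable_fun setT (fun p : (Z * n.-tuple E) * E => (p.2, p.1.2)).
    by apply: measurable_fun_pair => //; exact: measurableT_comp.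
  rewrite -[X in measurable X]setTI.
  have mc := measurable_comp_fun (@cmeas_in_resampling n) mh.
  exact: (mc measurableT [set true]).
by apply/seteqP; split => p /=; rewrite resampling_setP.
Qed.

(* The expectation of [f] after one pass through the loop body, started at [P]. *)
Definition prs_expect f P : \bar R :=
  pois_int mu a (resampling_set r P) (fun s => f (good r P `|` fset_of_seq s)%fset).

Hypothesis a0 : (0 <= a)%R.

Lemma prs_expect_ge0 f P : (forall Q, 0 <= f Q) -> 0 <= prs_expect f P.
Proof. by move=> f0; exact: pois_int_ge0. Qed.

(** The configuration enters through the domain of integration, handled by the measurable graph of
    the resampling set, and through the good part, a filter of [P] whose predicate depends on
    [P]. *)
Lemma cmeas_prs_expect dZ (Z : measurableType dZ) (f : Z -> {fset E} -> \bar R) :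
  cmeas f -> (forall v P, 0 <= f v P) -> cmeas (fun v P => prs_expect (f v) P).
Proof.
move=> mf f0 n.
apply: (@measurable_pois_int _ _ _ _ _ a0 _ (Z * n.-tuple E)%type
  (fun p => resampling_set r (fset_of_seq p.2))
  (fun p s => f p.1 (good r (fset_of_seq p.2) `|` fset_of_seq s)%fset)) => //.
  exact: measurable_resampling_graph.
move=> m.
pose g (p : Z * m.-tuple E) P := f p.1 (P `|` fset_of_seq p.2)%fset.
have mg : cmeas g.
  move=> k; have mh : measurable_fun setT
      (fun q : (Z * m.-tuple E) * k.-tuple E => ((q.1.1, q.1.2), q.2)).
    apply: measurable_fun_pair => //=.
    by apply: measurable_fun_pair => //=; exact: measurableT_comp.
  have mc : pmeas _ := pmeas_cat (n := m) mf.
  have := measurable_comp_fun (mc k) mh.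
  apply: eq_measurable_fun => -[[z q] s] _ /=.
  by rewrite /g /= fset_of_seq_cat fsetUC.
have := cmeas_filter (p := fun (q : (Z * m.-tuple E) * E) P => ~~ has (conflict r q.2) P) _ mg.
have mc : cmeas (fun (q : (Z * m.-tuple E) * E) P => ~~ has (conflict r q.2) P).
  by move=> k; apply: measurable_neg; exact: (cmeas_comp (h := snd) _ cmeas_conflict).
move=> /(_ mc) /(_ n) mgg.
have mh : measurable_fun setT
    (fun q : (Z * n.-tuple E) * m.-tuple E => ((q.1.1, q.2), q.1.2)).
  apply: measurable_fun_pair => /=; last exact: measurableT_comp.
  by apply: measurable_fun_pair => //=; exact: measurableT_comp.
have := measurable_comp_fun mgg mh.
by apply: eq_measurable_fun => q _ /=; rewrite /g goodE.
Qed.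

Lemma measurable_prs_expect f : measurable_fun setT f -> (forall P, 0 <= f P) ->
  measurable_fun setT (prs_expect f).
Proof.
move=> mf f0; apply: (cmeas_measurable (f := fun _ : unit => prs_expect f) tt).
by apply: (cmeas_prs_expect (f := fun _ : unit => f)) => //; apply: measurable_cmeas.
Qed.

Lemma measurable_fsetU (A : {fset E}) : measurable_fun setT (fun Q : {fset E} => (A `|` Q)%fset).
Proof.
apply: (cmeas_measurable (f := fun _ : unit => fun Q : {fset E} => (A `|` Q)%fset) tt).
have := cmeas_setU (f := fun (_ : unit) (P : {fset E}) => P) A.
by rewrite fset_of_seqK; apply; apply: measurable_cmeas.
Qed.

Hypothesis cube_fin : mu (cube R d) < +oo.

Lemma resampling_fin P : mu (resampling_set r P) < +oo.
Proof.
apply: le_lt_trans cube_fin; apply: le_measure; rewrite ?inE.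
- exact: measurable_resampling_set.
- exact: measurable_cube.
- by move=> z [].
Qed.

Definition prs_law P : giry {fset E} R :=
  giry_map (measurable_fsetU (good r P))
    (poisson_process mu a (measurable_resampling_set r P)).

Lemma prs_law_integral P f : measurable_fun setT f -> (forall P, 0 <= f P) ->
  \int[prs_law P]_Q f Q = prs_expect f P.
Proof.
move=> mf f0; rewrite [LHS]giry_int_map// /giry_int.
rewrite (poisson_process_integral a0)//; first exact: resampling_fin.
  by apply: (measurable_comp_fun mf); exact: measurable_fsetU.
by move=> Q; exact: f0.
Qed.

(** The conditional law, taken on the whole space, presents the law of [X t.+1] as the mixture of
    the laws [prs_law (X t w)]. *)
Lemma prs_run_integral d' (Omega : measurableType d') (Pr : probability Omega R)
    (X : nat -> Omega -> {fset E}) t f :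
  prs_run lambda r Pr X -> measurable_fun setT f -> (forall P, 0 <= f P) ->
  \int[Pr]_w f (X t.+1 w) = \int[Pr]_w prs_expect f (X t w).
Proof.
move=> [mX _ hX] mf f0.
have E1 : \int[Pr]_w f (X t.+1 w) = \int[giry_map (mX t.+1) Pr]_P f P.
  by rewrite [RHS]giry_int_map.
rewrite E1 (@integral_mixture _ _ _ _ _ Pr (fun w => prs_law (X t w)))//.
- by apply: eq_integral => w _; rewrite prs_law_integral.
- move=> A mA.
  apply: (eq_measurable_fun (fun w => prs_expect (fun P => (\1_A P)%:E) (X t w))).
    move=> w _; rewrite -prs_law_integral//; last first.
      by apply/measurable_EFinP; exact: measurable_indic.
    by rewrite integral_indic// setIT.
  apply: (measurable_comp_fun _ (mX t)); apply: measurable_prs_expect => //.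
  by apply/measurable_EFinP; exact: measurable_indic.
- move=> A mA; rewrite /= /pushforward -[X in Pr X]setTI hX//.
  rewrite /history; set G := \bigcup_(_ in _) _.
  have [h0 hC _] := smallest_sigma_algebra setT G.
  by have := hC _ h0; rewrite setD0.
Qed.

End resampling_kernel.

(** * The effect of one pass on sums over good points *)

Section contraction.
Context (R : realType) (d : nat) (lambda r : R).
Local Notation E := (euclid R d).
Local Notation a := (intensity d lambda r).
Local Notation mu := (volume R d).
Local Notation S := (resampling_set r).
Local Notation K := (prs_expect lambda r).
Implicit Types (P Q : {fset E}) (x y z : E) (f : {fset E} -> \bar R)
  (F : E -> {fset E} -> \bar R).
Hypothesis a0 : (0 <= a)%R.
Hypothesis mu1 : forall x : E, measurable [set x] /\ mu [set x] = 0.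
Hypothesis cube1 : mu (cube R d) = 1.

Let cube_fin : mu (cube R d) < +oo. Proof. by rewrite cube1 ltry. Qed.
Let Sfin P : mu (S P) < +oo. Proof. exact: resampling_fin. Qed.
Let mS P : measurable (S P). Proof. exact: measurable_resampling_set. Qed.
Local Notation meq := (@measurable_eq_euclid R d).

(* The left-hand side of the domination inequality. *)
Definition gsum F P : \bar R := \sum_(y <- good r P) F y (P `\ y)%fset.

Lemma gsum_ge0 F P : (forall y Q, 0 <= F y Q) -> 0 <= gsum F P.
Proof. by move=> F0; apply: sume_ge0. Qed.

Lemma measurable_gsum F : cmeas F -> measurable_fun setT (gsum F).
Proof.
move=> mF; apply: (cmeas_measurable (f := fun _ : unit => gsum F) tt).
have := @cmeas_sum _ _ meq R _ unit (fun p P =>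
  if has (conflict r p.2) P then 0 else F p.2 (P `\ p.2)%fset).
move=> H.
rewrite (_ : (fun _ : unit => gsum F) = (fun _ P => \sum_(y <- P)
    if has (conflict r y) P then 0 else F y (P `\ y)%fset)); last first.
  apply/funext => _; apply/funext => P; rewrite /gsum goodE big_fset /=.
  by rewrite big_mkcond/=; apply: eq_bigr => y _; rewrite if_neg.
apply: H => n; apply: measurable_fun_ifT => //.
  exact: (cmeas_comp (h := snd) _ (@cmeas_conflict R d r)).
apply: (cmeas_D1 meq (f := fun (p : unit * E) P => F p.2 P)).
exact: (cmeas_comp (h := snd) _ mF).
Qed.

Lemma smeas_fsetU f (A : {fset E}) : measurable_fun setT f ->
  smeas (fun s => f (A `|` fset_of_seq s)%fset).
Proof.
move=> mf; apply/(measurable_configurationP (fun Q => f (A `|` Q)%fset)).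
by apply: (measurable_comp_fun mf); exact: measurable_fsetU.
Qed.

Lemma pois_int_big P (l : seq E) (G : E -> seq E -> \bar R) :
  (forall y, smeas (G y)) -> (forall y s, 0 <= G y s) ->
  pois_int mu a (S P) (fun s => \sum_(y <- l) G y s) =
  \sum_(y <- l) pois_int mu a (S P) (G y).
Proof.
move=> mG G0; elim: l => [|y l IHl].
  by under eq_fun do rewrite big_nil; rewrite big_nil pois_int_cst.
under eq_fun do rewrite big_cons; rewrite big_cons -IHl pois_intD//.
  by move=> n; apply: emeasurable_sum => x; exact: (mG x n).
by move=> s; exact: sume_ge0.
Qed.

Lemma big_fsetU_disjoint (A B : {fset E}) (G : E -> \bar R) :
  (forall y, y \in A -> y \notin B) ->
  \sum_(y <- (A `|` B)%fset) G y = \sum_(y <- A) G y + \sum_(y <- B) G y.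
Proof.
move=> AB; rewrite -big_cat/=; apply: perm_big; apply: uniq_perm; rewrite ?fset_uniq//.
  rewrite cat_uniq !fset_uniq /= andbT; apply/hasPn => y yB.
  by apply: contraTN yB => /AB.
by move=> y; rewrite mem_cat in_fsetU.
Qed.

Lemma cmeas_fixedU F A : cmeas F -> cmeas (fun y Q => F y (A `|` Q)%fset).
Proof. by move=> mF; have := cmeas_setU A mF; rewrite fset_of_seqK. Qed.

(** Points of the next configuration are old good points or fresh ones. Mecke's formula on the
    resampling set handles the fresh ones. An old good [y] can be deleted before the pass: the
    resampling set stays the same and the good part merely loses [y], so the kernel started without
    [y] appears. The test [in_resampling] is false at such [y]; it is inserted so that, after
    integration over the cube, the first term leaves room for the second. *)
Lemma prs_expect_gsum_le F P : cmeas F -> (forall y Q, 0 <= F y Q) ->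
  K (gsum F) P <=
  gsum (fun y Q => if in_resampling r Q y then 0 else K (F y) Q) P +
  a%:E * \int[mu]_(y in S P) K (F y) P.
Proof.
move=> mF F0; set A := good r P.
pose G1 y s := F y ((A `\ y) `|` fset_of_seq s)%fset.
pose F2 y Q := F y (A `|` Q)%fset.
have mFy y : measurable_fun setT (F y) by exact: cmeas_measurable.
have mG1 y : smeas (G1 y) by exact: (smeas_fsetU (A `\ y)%fset (mFy y)).
have mF2 : cmeas F2 by exact: cmeas_fixedU.
pose phi1 s := \sum_(y <- A) G1 y s.
pose phi2 s := \sum_(y <- fset_of_seq s) F2 y (fset_of_seq s `\ y)%fset.
have m1 : smeas phi1 by move=> n; apply: emeasurable_sum => x; exact: (mG1 x n).
have m2 : smeas phi2.
  have := @cmeas_sum _ _ meq R _ unit (fun p P => F2 p.2 (P `\ p.2)%fset).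
  move=> /(_ _)/(pmeas_smeas tt); apply.
  apply: (cmeas_D1 meq (f := fun (p : unit * E) P => F2 p.2 P)).
  exact: (cmeas_comp (h := snd) _ mF2).
have p10 s : 0 <= phi1 s by apply: sume_ge0 => y _; exact: F0.
have p20 s : 0 <= phi2 s by apply: sume_ge0 => y _; exact: F0.
apply: (@le_trans _ _ (pois_int mu a (S P) (fun s => phi1 s + phi2 s))).
  apply: (le_pois_int a0 mu1) => //.
  - exact: (smeas_fsetU A (measurable_gsum mF)).
  - by move=> n; exact: (emeasurable_funD (m1 n) (m2 n)).
  - by move=> s; exact: gsum_ge0.
  - by move=> s; exact: adde_ge0.
  move=> s us hs.
  (* Fresh points lie in the resampling set, which good points avoid. *)
  have disj y : y \in A -> y \notin fset_of_seq s.
    move=> yA; rewrite mem_fset_of_seq; apply/negP => /hs/resampling_setP.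
    by apply/negP; exact: good_notin_resampling.
  rewrite /gsum goodE big_fset/= big_mkcond/=.
  (* From here on every point of the next configuration is counted, good or not. *)
  apply: (@le_trans _ _ (\sum_(y <- (A `|` fset_of_seq s)%fset)
      F y ((A `|` fset_of_seq s) `\ y)%fset)).
    by apply: lee_sum => y _; case: ifP.
  rewrite big_fsetU_disjoint//; apply: leeD.
    rewrite /phi1 !big_seq; apply: lee_sum => y yA; rewrite /G1.
    rewrite (_ : (_ `\ y = A `\ y `|` fset_of_seq s)%fset)//.
    apply/fsetP => z; rewrite !(in_fsetD1, in_fsetU).
    by case: eqVneq => //= ->; rewrite (negbTE (disj _ yA)).
  rewrite /phi2 !big_seq; apply: lee_sum => y ys; rewrite /F2.
  rewrite (_ : (_ `\ y = A `|` (fset_of_seq s `\ y))%fset)//.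
  apply/fsetP => z; rewrite !(in_fsetD1, in_fsetU).
  case: eqVneq => //= ->; rewrite orbF; apply/esym/negbTE.
  by apply: contraTN ys => /disj.
have E2 : pois_int mu a (S P) phi2 = a%:E * \int[mu]_(y in S P) K (F y) P.
  exact: (mecke a0 meq mu1 (mS P) (Sfin P) mF2 (fun y Q => F0 y _)).
have E1 : pois_int mu a (S P) phi1 = \sum_(y <- A) pois_int mu a (S P) (G1 y).
  by rewrite pois_int_big// => y s; exact: F0.
rewrite pois_intD// E1 E2.
apply: leeD => //; rewrite /gsum !big_seq; apply: lee_sum => y yA.
rewrite in_resampling_fsetD1// (negbTE (good_notin_resampling yA)).
rewrite /prs_expect good_fsetD1// (_ : S (P `\ y)%fset = S P)//.
by apply/seteqP; split => z /resampling_setP h; apply/resampling_setP;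
  move: h; rewrite in_resampling_fsetD1.
Qed.

(** The first integrand vanishes on the resampling set, so the two integrals make up one over the
    cube, and Tonelli's theorem brings it under the kernel. This identity closes the induction of
    [good_domination]. *)
Lemma integral_resampling_split F P : cmeas F -> (forall y Q, 0 <= F y Q) ->
  \int[mu]_(y in cube R d) (if in_resampling r P y then 0 else K (F y) P) +
  \int[mu]_(y in S P) K (F y) P =
  K (fun Q => \int[mu]_(y in cube R d) F y Q) P.
Proof.
move=> mF F0.
have K0 y : 0 <= K (F y) P by exact: prs_expect_ge0.
have mK : measurable_fun setT (fun y => K (F y) P).
  have mc := cmeas_prs_expect a0 mF F0.
  rewrite -[P]fset_of_seqK.
  have mc' : measurable_fun _ _ := mc (size P).
  exact: (measurable_comp_fun mc' (pair2_measurable (in_tuple P))).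
have -> : K (fun Q => \int[mu]_(y in cube R d) F y Q) P =
    \int[mu]_(y in cube R d) K (F y) P.
  rewrite /prs_expect pois_int_integral//; first exact: measurable_cube.
  exact: (cmeas_fixedU (good r P) mF).
have mD : measurable (cube R d `\` S P).
  by apply: measurableD => //; exact: measurable_cube.
have cubeE : cube R d = (cube R d `\` S P) `|` S P.
  by rewrite setUC setDUK// => z [].
have disj : [disjoint cube R d `\` S P & S P].
  by rewrite disj_set2E setDE -setIA setICl setI0.
rewrite [in RHS]cubeE ge0_integral_setU//; last exact: measurable_funTS.
congr (_ + _).
have mK' : measurable_fun (cube R d) (fun y => if in_resampling r P y then 0 else K (F y) P).
  apply: measurable_funTS; apply: measurable_fun_ifT => //.
  rewrite -[P]fset_of_seqK.
  have mc := @cmeas_in_resampling R d r (size P).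
  exact: (measurable_comp_fun mc (pair2_measurable (in_tuple P))).
rewrite [in LHS]cubeE ge0_integral_setU//; last 2 first.
- by rewrite -cubeE.
- by move=> y _; case: ifP.
rewrite [X in _ + X](_ : _ = 0) ?adde0; last first.
  by apply: integral0_eq => y /resampling_setP ->.
apply: eq_integral => y; rewrite inE => -[_ yS].
by case: ifP => // /resampling_setP.
Qed.

End contraction.

(** * Decay of the number of bad points *)

Lemma measurable_indicator d (T : measurableType d) (R : realType) (p : T -> bool) :
  measurable_fun setT p -> measurable_fun setT (fun x => (p x)%:R%:E : \bar R).
Proof.
move=> mp; rewrite (_ : (fun _ => _) = (fun x => if p x then 1 else 0)).
  exact: measurable_fun_ifT.
by apply/funext => x; case: (p x).
Qed.

Lemma measure_bigsetU_le d (T : measurableType d) (R : realType)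
    (m : {measure set T -> \bar R}) (I : Type) (s : seq I) (B : I -> set T) (V : R) :
  (forall i, measurable (B i)) -> (forall i, m (B i) <= V%:E) ->
  m (\big[setU/set0]_(i <- s) B i) <= V%:E * (size s)%:R%:E.
Proof.
move=> mB BV; elim: s => [|i s IHs]; first by rewrite big_nil measure0 mule0.
rewrite big_cons (le_trans (measureU2 _ _ _))//; first exact: bigsetU_measurable.
by rewrite /= -nat1r EFinD muleDr ?mule1// leeD.
Qed.

Section invariant.
Context (R : realType) (d : nat) (lambda r : R).
Local Notation E := (euclid R d).
Local Notation a := (intensity d lambda r).
Local Notation mu := (volume R d).
Local Notation S := (resampling_set r).
Local Notation K := (prs_expect lambda r).
Implicit Types (P Q : {fset E}) (x y z : E) (f : {fset E} -> \bar R)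
  (F : E -> {fset E} -> \bar R).
Hypothesis a0 : (0 <= a)%R.
Hypothesis mu1 : forall x : E, measurable [set x] /\ mu [set x] = 0.
Hypothesis cube1 : mu (cube R d) = 1.

Let cube_fin : mu (cube R d) < +oo. Proof. by rewrite cube1 ltry. Qed.
Let Sfin P : mu (S P) < +oo. Proof. exact: resampling_fin. Qed.
Let mS P : measurable (S P). Proof. exact: measurable_resampling_set. Qed.
Local Notation meq := (@measurable_eq_euclid R d).

Lemma measurable_cmeas_integral (D : {fset E} -> set E) F :
  (forall n, measurable [set p : (n.-tuple E * E)%type | D (fset_of_seq p.1) p.2]) ->
  cmeas F -> (forall y Q, 0 <= F y Q) ->
  measurable_fun setT (fun P => \int[mu]_(y in D P) F y P).
Proof.
move=> mD mF F0; apply/measurable_configurationP => n.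
apply: (@measurable_section_integral _ _ _ mu _ _ (fun q : n.-tuple E => D (fset_of_seq q))
  (fun q y => F y (fset_of_seq q))) => //; first exact: mD.
have mh : measurable_fun setT (fun p : n.-tuple E * E => (p.2, p.1)) by exact: measurable_fun_pair.
have mF' : measurable_fun _ _ := mF n.
exact: (measurable_comp_fun mF' mh).
Qed.

Lemma measurable_cmeas_cube_integral F : cmeas F -> (forall y Q, 0 <= F y Q) ->
  measurable_fun setT (fun P => \int[mu]_(y in cube R d) F y P).
Proof.
move=> mF F0; apply: (measurable_cmeas_integral (D := fun=> cube R d) _ mF F0) => n.
by apply: measurable_const_section; exact: measurable_cube.
Qed.

Lemma measurable_cmeas_resampling_integral F : cmeas F -> (forall y Q, 0 <= F y Q) ->
  measurable_fun setT (fun P => \int[mu]_(y in S P) F y P).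
Proof.
move=> mF F0; apply: (measurable_cmeas_integral (D := fun P => S P) _ mF F0) => n.
have mh : measurable_fun setT (fun p : n.-tuple E * E => ((tt, p.1), p.2)).
  by apply: measurable_fun_pair => //=; exact: measurable_fun_pair.
have := mh measurableT _ (@measurable_resampling_graph R d r _ unit n).
by rewrite setTI.
Qed.

Variables (d' : measure_display) (Omega : measurableType d').
Variables (Pr : probability Omega R) (X : nat -> Omega -> {fset E}).
Hypothesis runX : prs_run lambda r Pr X.

Let mX t : measurable_fun setT (X t). Proof. by case: runX. Qed.

Lemma run_integral0 f : measurable_fun setT f -> (forall P, 0 <= f P) ->
  \int[Pr]_w f (X 0%N w) = pois_int mu a (cube R d) (fun s => f (fset_of_seq s)).
Proof.
move=> mf f0; rewrite -(poisson_process_integral a0 (measurable_cube R d))//.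
transitivity (\int[giry_map (mX 0) Pr]_P f P); first by rewrite [RHS]giry_int_map.
by apply: eq_measure_integral => A mA _; case: runX => _ + _; exact.
Qed.

Let run_integralS t f : measurable_fun setT f -> (forall P, 0 <= f P) ->
  \int[Pr]_w f (X t.+1 w) = \int[Pr]_w K f (X t w).
Proof. by move=> mf f0; rewrite (prs_run_integral a0 cube_fin t runX). Qed.

(* The good points are dominated by the Poisson process: an inequality of
   Georgii-Nguyen-Zessin type, preserved by the loop. *)
Lemma good_domination t F : cmeas F -> (forall y Q, 0 <= F y Q) ->
  \int[Pr]_w gsum r F (X t w) <= a%:E * \int[Pr]_w \int[mu]_(y in cube R d) F y (X t w).
Proof.
elim: t F => [|t IHt] F mF F0.
  rewrite (run_integral0 (measurable_gsum r mF)); last by move=> P; exact: gsum_ge0.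
  rewrite (run_integral0 (measurable_cmeas_cube_integral mF F0)); last first.
    by move=> P; exact: integral_ge0.
  have mcube := measurable_cube R d.
  rewrite pois_int_integral//.
  rewrite -(mecke a0 meq mu1 mcube cube_fin mF F0).
  apply: (le_pois_int a0 mu1 mcube).
  - exact: (iffLR (measurable_configurationP _) (measurable_gsum r mF)).
  - have := @cmeas_sum _ _ meq R _ unit (fun p P => F p.2 (P `\ p.2)%fset).
    move=> /(_ _)/(pmeas_smeas tt); apply.
    apply: (cmeas_D1 meq (f := fun (p : unit * E) P => F p.2 P)).
    exact: (cmeas_comp (h := snd) _ mF).
  - by move=> s; exact: gsum_ge0.
  - by move=> s; exact: sume_ge0.
  move=> s _ _; rewrite /gsum goodE big_fset/= big_mkcond/=.
  by apply: lee_sum => y _; case: ifP.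
have K0 y P : 0 <= K (F y) P by exact: prs_expect_ge0.
have mK : cmeas (fun y P => K (F y) P) by exact: cmeas_prs_expect.
(* What one pass makes of [F] outside the resampling set. The induction hypothesis is applied to
   [G]. *)
pose G y P := if in_resampling r P y then 0 else K (F y) P.
have mG : cmeas G.
  move=> n; apply: measurable_fun_ifT => //; last exact: (mK n).
  exact: (@cmeas_in_resampling R d r n).
have G0 y P : 0 <= G y P by rewrite /G; case: ifP.
have mcomp f : measurable_fun setT f -> measurable_fun setT (fun w => f (X t w)).
  by move=> mf; exact: (measurable_comp_fun mf (mX t)).
rewrite (run_integralS _ (measurable_gsum r mF)); last by move=> P; exact: gsum_ge0.
rewrite (run_integralS _ (measurable_cmeas_cube_integral mF F0)); last first.
  by move=> P; exact: integral_ge0.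
under [in leRHS]eq_integral do rewrite -(integral_resampling_split a0 _ mF F0).
have mSi := mcomp _ (measurable_cmeas_resampling_integral mK K0).
have mCi := mcomp _ (measurable_cmeas_cube_integral mG G0).
apply: (@le_trans _ _ (\int[Pr]_w (gsum r G (X t w) +
    a%:E * \int[mu]_(y in S (X t w)) K (F y) (X t w)))).
  apply: ge0_le_integral => //.
  - by move=> w _; apply: prs_expect_ge0 => // P; exact: gsum_ge0.
  - apply: mcomp; apply: measurable_prs_expect => //; first exact: measurable_gsum.
    by move=> P; exact: gsum_ge0.
  - apply: emeasurable_funD; first by apply: mcomp; exact: measurable_gsum.
    exact: measurable_funeM.
  - by move=> w _; exact: prs_expect_gsum_le.
rewrite ge0_integralD//; last 4 first.
- by move=> w _; exact: gsum_ge0.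
- by apply: mcomp; exact: measurable_gsum.
- by move=> w _; rewrite mule_ge0// integral_ge0.
- exact: measurable_funeM.
rewrite ge0_integralZl//; last by move=> w _; exact: integral_ge0.
rewrite [in leRHS]ge0_integralD//; last 2 first.
- by move=> w _; apply: integral_ge0 => y _; exact: (G0 y (X t w)).
- by move=> w _; exact: integral_ge0.
rewrite [in leRHS]ge0_muleDr; last 2 first.
- by apply: integral_ge0 => w _; apply: integral_ge0 => y _; exact: (G0 y (X t w)).
- by apply: integral_ge0 => w _; exact: integral_ge0.
by rewrite leeD2r//; exact: (IHt G mG G0).
Qed.


Variable V : R.
Hypothesis V0 : (0 <= V)%R.
Hypothesis ballV : forall x, mu (open_ball x (2 * r)) <= V%:E.

Let aaVE : (a * a * V)%:E = a%:E * (a%:E * V%:E) :> \bar R.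
Proof. by rewrite -!EFinM mulrA. Qed.

Let ind x y : \bar R := (nearby r x y)%:R%:E.
Let ind0 x y : 0 <= ind x y. Proof. by rewrite lee_fin. Qed.
Let mind : measurable_fun [set: (E * E)%type] (fun p => ind p.1 p.2).
Proof.
exact: (measurable_indicator (@measurable_nearby R d r)).
Qed.
Let mindr x : measurable_fun setT (ind x).
Proof. exact: (measurable_comp_fun mind (pair1_measurable x)). Qed.

Let cnt x Q : \bar R := \sum_(y <- Q) ind x y.
Let cnt0 x Q : 0 <= cnt x Q. Proof. exact: sume_ge0. Qed.
Let mcnt : cmeas cnt.
Proof.
apply: (cmeas_sum meq (g := fun p _ => ind p.1 p.2)).
exact: (cmeas_param (g := fun p : E * E => ind p.1 p.2)).
Qed.

Let countE x Q : (count (nearby r x) Q)%:R%:E = cnt x Q :> \bar R.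
Proof.
rewrite /cnt /ind -sum1_count big_mkcond/= natr_sum -sumEFin.
by apply: eq_bigr => y _; case: nearby.
Qed.

Lemma measurable_card_bad_points :
  measurable_fun setT (fun P => #|` bad_points r P|%:R%:E : \bar R).
Proof.
apply: (cmeas_measurable (f := fun _ : unit => fun P => #|` bad_points r P|%:R%:E) tt).
rewrite (_ : (fun _ => _) = fun _ P => \sum_(x <- P) (has (conflict r x) P)%:R%:E); last first.
  apply/funext => _; apply/funext => P.
  rewrite card_bad_points -sum1_count big_mkcond/= natr_sum -sumEFin.
  by apply: eq_bigr => y _; case: has.
apply: (cmeas_sum meq (g := fun (p : unit * E) P => (has (conflict r p.2) P)%:R%:E)) => n.
apply: measurable_indicator.
have mc : cmeas (fun (p : unit * E) P => has (conflict r p.2) P).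
  exact: (cmeas_comp measurable_snd (@cmeas_conflict R d r)).
exact: (mc n).
Qed.

Let bad P : \bar R := #|` bad_points r P|%:R%:E.
Let bad0 P : 0 <= bad P. Proof. by rewrite lee_fin. Qed.
Let mbad : measurable_fun setT bad := measurable_card_bad_points.

Lemma nearby_integral_le (D : set E) x : measurable D ->
  \int[mu]_(y in D) ind x y <= V%:E.
Proof.
move=> mD; rewrite (eq_integral (fun y => (\1_(open_ball x (2 * r)) y)%:E)); last first.
  move=> y _; rewrite /ind indicE; congr (_%:R%:E); congr nat_of_bool.
  by apply/idP/idP; rewrite inE /open_ball /= /nearby edistC.
rewrite integral_indic//; last exact: measurable_open_ball.
apply: le_trans (ballV x); apply: le_measure; rewrite ?inE//.
- by apply: measurableI => //; exact: measurable_open_ball.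
- exact: measurable_open_ball.
Qed.

Lemma nearby_integral2_le (D D' : set E) : measurable D -> measurable D' ->
  \int[mu]_(x in D) \int[mu]_(y in D') ind x y <= V%:E * mu D.
Proof.
move=> mD mD'; rewrite -integral_cst//; apply: ge0_le_integral => //.
- by move=> x _; exact: integral_ge0.
- apply: measurable_funTS; apply: measurable_section_integral => //.
  exact: measurable_const_section.
- by move=> x _; exact: nearby_integral_le.
Qed.

(** Mecke's formula for one point of the pair and Campbell's for the other give a factor [a] each;
    given the first point, the second has volume at most [V] to fall in. *)
Lemma pois_int_pairs_le (D : set E) : measurable D -> mu D < +oo ->
  pois_int mu a D (fun s => \sum_(x <- fset_of_seq s) cnt x (fset_of_seq s `\ x)%fset) <=
  (a * a * V)%:E * mu D.
Proof.
move=> mD Dfin; rewrite (mecke a0 meq mu1 mD Dfin mcnt cnt0).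
under eq_integral do rewrite (pois_int_sum a0 meq mu1 mD Dfin (mindr _) (ind0 _)).
rewrite ge0_integralZl//; last 2 first.
- apply: measurable_funTS; apply: measurable_section_integral => //.
  exact: measurable_const_section.
- by move=> x _; exact: integral_ge0.
rewrite aaVE -!muleA; do 2 apply: lee_wpmul2l => //.
exact: nearby_integral2_le.
Qed.

Lemma volume_resampling_le P : mu (S P) <= V%:E * bad P.
Proof.
apply: (@le_trans _ _ (mu (\bigcup_(x in [set` bad_points r P]) open_ball x (2 * r)))).
  apply: le_measure; rewrite ?inE//; last by move=> z [].
  by apply: fin_bigcup_measurable => // x _; exact: measurable_open_ball.
rewrite bigcup_fset; apply: measure_bigsetU_le => // x.
exact: measurable_open_ball.
Qed.

(** Multiplied by [a], this is the expected number of fresh points near [y]. *)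
Let W y P := \int[mu]_(x in S P) ind y x.
Let W0 y P : 0 <= W y P. Proof. exact: integral_ge0. Qed.
Let mW : cmeas W.
Proof.
move=> n; apply: (@measurable_section_integral _ _ _ mu _ _
  (fun q : E * n.-tuple E => S (fset_of_seq q.2)) (fun q => ind q.1)) => //.
  exact: measurable_resampling_graph.
apply: (measurable_comp_fun (f := fun q : (E * n.-tuple E) * E => (q.1.1, q.2)) mind).
by apply: measurable_fun_pair => //; exact: measurableT_comp.
Qed.

Let indC x y : ind x y = ind y x. Proof. by rewrite /ind nearbyC. Qed.

(** This integrates [card_bad_points_step] over the fresh points. Mixed pairs give, by Campbell's
    formula, [a] times the sum of [W] over the good points; it is kept as a [gsum] so that
    [good_domination] applies after averaging over the run. *)
Lemma prs_expect_bad_le P :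
  K bad P <= (a * a * V)%:E * mu (S P) + 2%:E * (a%:E * gsum r W P).
Proof.
set A := good r P.
pose phi1 s := \sum_(x <- fset_of_seq s) cnt x (fset_of_seq s `\ x)%fset.
pose phi2 s := \sum_(x <- fset_of_seq s) cnt x A.
have m1 : smeas phi1.
  have := @cmeas_sum _ _ meq R _ unit (fun p P => cnt p.2 (P `\ p.2)%fset).
  move=> /(_ _)/(pmeas_smeas tt); apply.
  apply: (cmeas_D1 meq (f := fun (p : unit * E) P => cnt p.2 P)).
  exact: (cmeas_comp (h := snd) _ mcnt).
have mcA : measurable_fun setT (cnt ^~ A).
  rewrite (_ : cnt^~ A = fun x => \sum_(y <- A) ind x y)//.
  apply: emeasurable_sum => y.
  by rewrite (_ : ind^~ y = ind y)//; apply/funext => x; exact: indC.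
have m2 : smeas phi2.
  have := @cmeas_sum _ _ meq R _ unit (fun p _ => cnt p.2 A).
  move=> /(_ _)/(pmeas_smeas tt); apply.
  apply: (cmeas_param (g := fun p : unit * E => cnt p.2 A)).
  exact: (measurable_comp_fun mcA).
have p10 s : 0 <= phi1 s by exact: sume_ge0.
have p20 s : 0 <= phi2 s by exact: sume_ge0.
have m22 : smeas (fun s => phi2 s + phi2 s).
  by move=> n; exact: (emeasurable_funD (m2 n) (m2 n)).
have p220 s : 0 <= phi2 s + phi2 s by exact: adde_ge0.
apply: (@le_trans _ _ (pois_int mu a (S P) (fun s => phi1 s + (phi2 s + phi2 s)))).
  apply: (le_pois_int a0 mu1) => //.
  - exact: smeas_fsetU.
  - by move=> n; exact: (emeasurable_funD (m1 n) (m22 n)).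
  - by move=> s; exact: adde_ge0.
  move=> s _ _; rewrite /bad.
  apply: (@le_trans _ _ (\sum_(x <- fset_of_seq s)
      count (nearby r x) (fset_of_seq s `\ x)%fset +
      (\sum_(x <- fset_of_seq s) count (nearby r x) (good r P)).*2)%:R%:E).
    by rewrite lee_fin ler_nat card_bad_points_step.
  rewrite natrD -addnn natrD !EFinD !natr_sum -!sumEFin.
  rewrite /phi1 /phi2; apply: leeD; last apply: leeD.
  - by under eq_bigr do rewrite countE.
  - by under eq_bigr do rewrite countE.
  - by under eq_bigr do rewrite countE.
rewrite !pois_intD//; apply: leeD; first exact: pois_int_pairs_le.
have -> : pois_int mu a (S P) phi2 = a%:E * gsum r W P.
  rewrite (pois_int_sum a0 meq mu1)//; congr (_ * _).
  rewrite ge0_integral_sum//; last first.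
    move=> y; rewrite (_ : ind^~ y = ind y); last by apply/funext => x; exact: indC.
    exact: measurable_funTS.
  rewrite /gsum !big_seq; apply: eq_bigr => y yA.
  rewrite /W (_ : S (P `\ y)%fset = S P).
    by apply: eq_integral => x _; exact: indC.
  by apply/seteqP; split => z /resampling_setP h; apply/resampling_setP;
    move: h; rewrite in_resampling_fsetD1.
by rewrite -[2%R]/(1 + 1)%R EFinD ge0_muleDl// !mul1e.
Qed.

(** Tonelli's theorem: each [x] in the resampling set is near a set of [y] of volume at most [V]. *)
Lemma cube_integral_W_le P : \int[mu]_(y in cube R d) W y P <= V%:E * mu (S P).
Proof.
(* [phi] reads only the head, so [iint_integral] at length one is the exchange of the two
   integrals. *)
pose phi (z : E) s := if s is y :: _ then ind y z else 0.
have phi0 z s : 0 <= phi z s by case: s => //= y s.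
have mphi : pmeas phi.
  case=> [|n].
    rewrite (_ : (fun _ => _) = cst 0)//.
    by apply/funext => -[z q] /=; rewrite (tuple0 q).
  apply: (measurable_uncons (f := phi)) => /=.
  apply: (measurable_comp_fun (f := fun q : (E * E) * n.-tuple E => (q.1.2, q.1.1)) mind).
  by apply: measurable_fun_pair => //; exact: measurableT_comp.
have := @iint_integral _ _ _ mu (cube R d) 1 _ _ mu (S P) phi (measurable_cube R d)
  (mS P) mphi phi0.
rewrite /= => ->.
apply: le_trans (nearby_integral2_le (mS P) (measurable_cube R d)).
rewrite le_eqVlt; apply/orP; left; apply/eqP.
by apply: eq_integral => x _; apply: eq_integral => y _; exact: indC.
Qed.

(** The [3] is one for pairs of fresh points plus two for mixed pairs, counted from both ends. Each
    share is at most [a^2 V] times the mean volume of the resampling set, itself at most [V] times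
    the mean number of bad points. *)
Lemma expected_bad_points_step t :
  \int[Pr]_w bad (X t.+1 w) <= (3 * (a * V) ^+ 2)%:E * \int[Pr]_w bad (X t w).
Proof.
have mcomp f : measurable_fun setT f -> measurable_fun setT (fun w => f (X t w)).
  by move=> mf; exact: (measurable_comp_fun mf (mX t)).
have mSv : measurable_fun setT (fun P => mu (S P)).
  have := measurable_cmeas_resampling_integral (F := fun _ _ => 1) _ _.
  have mc1 : cmeas (fun (_ : E) (_ : {fset E}) => 1 : \bar R) by move=> n.
  move=> /(_ mc1 (fun _ _ => lee01)); apply: eq_measurable_fun => P _.
  by rewrite [LHS](@integral_cst _ _ _ _ (S P) (mS P) 1) mul1e.
have aaV00 : (0 <= a * a * V)%R := mulr_ge0 (mulr_ge0 a0 a0) V0.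
have aaV0 : 0 <= (a * a * V)%:E by rewrite lee_fin.
pose s := \int[Pr]_w mu (S (X t w)).
have s0 : 0 <= s by exact: integral_ge0.
have mgW := measurable_gsum r mW.
have gW0 P : 0 <= gsum r W P by exact: gsum_ge0.
have h1 : \int[Pr]_w bad (X t.+1 w) <= (a * a * V)%:E * s +
    2%:E * (a%:E * \int[Pr]_w gsum r W (X t w)).
  rewrite run_integralS//.
  have mgX : measurable_fun setT (fun w => gsum r W (X t w)) by exact: mcomp.
  have mSX : measurable_fun setT (fun w => mu (S (X t w))) := mcomp _ mSv.
  rewrite /s -ge0_integralZl// -[X in 2%:E * X]ge0_integralZl// -[X in _ + X]ge0_integralZl//; last 2 first.
  - exact: measurable_funeM.
  - by move=> w _; rewrite mule_ge0.
  rewrite -ge0_integralD//; last 4 first.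
  - by move=> w _; rewrite mule_ge0.
  - exact: measurable_funeM.
  - by move=> w _; rewrite !mule_ge0.
  - by do 2 apply: measurable_funeM.
  apply: ge0_le_integral => //.
  - by move=> w _; exact: prs_expect_ge0.
  - exact: (mcomp _ (measurable_prs_expect a0 mbad bad0)).
  - apply: emeasurable_funD; first exact: measurable_funeM.
    by do 2 apply: measurable_funeM.
  - by move=> w _; exact: prs_expect_bad_le.
apply: (le_trans h1).
have h2 : \int[Pr]_w gsum r W (X t w) <= a%:E * (V%:E * s).
  apply: (le_trans (good_domination t mW W0)).
  have mSX : measurable_fun setT (fun w => mu (S (X t w))) := mcomp _ mSv.
  rewrite lee_wpmul2l// /s -ge0_integralZl//.
  apply: ge0_le_integral => //.
  - by move=> w _; exact: integral_ge0.
  - exact: (mcomp _ (measurable_cmeas_cube_integral mW W0)).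
  - exact: measurable_funeM.
  - by move=> w _; exact: cube_integral_W_le.
have h3 : s <= V%:E * \int[Pr]_w bad (X t w).
  have mbX : measurable_fun setT (fun w => bad (X t w)) := mcomp _ mbad.
  rewrite -ge0_integralZl//.
  apply: ge0_le_integral => //.
  - exact: (mcomp _ mSv).
  - exact: measurable_funeM.
  - by move=> w _; exact: volume_resampling_le.
apply: (@le_trans _ _ ((3 * (a * a * V))%:E * s)).
  rewrite (_ : 3 * (a * a * V) = a * a * V + 2 * (a * (a * V)))%R; last by ring.
  have aaV20 : (0 <= 2 * (a * (a * V)))%R.
    by do 2 (apply: mulr_ge0 => //); exact: mulr_ge0.
  rewrite [X in _ <= X * _]EFinD [leRHS]ge0_muleDl ?lee_fin//; apply: leeD => //.
  rewrite (_ : (2 * (a * (a * V)))%:E = 2%:E * (a%:E * (a%:E * V%:E))); last by rewrite !EFinM.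
  by rewrite -!muleA; do 2 apply: lee_wpmul2l => //.
apply: le_trans (lee_wpmul2l _ h3) _; first by rewrite lee_fin; apply: mulr_ge0.
by rewrite muleA -EFinM (_ : 3 * (a * a * V) * V = 3 * (a * V) ^+ 2)%R//; ring.
Qed.

Lemma expected_bad_points t : \int[Pr]_w #|` bad_points r (X t w)|%:R%:E <=
  ((3 * (a * V) ^+ 2) ^+ t * (a * a * V))%:E.
Proof.
elim: t => [|t IHt]; last first.
  apply: (le_trans (expected_bad_points_step t)).
  have c0 : 0 <= (3 * (a * V) ^+ 2)%:E :> \bar R.
    by rewrite lee_fin; apply: mulr_ge0 => //; apply: exprn_ge0; exact: mulr_ge0.
  apply: (le_trans (lee_wpmul2l c0 IHt)).
  by rewrite -EFinM lee_fin (exprS _ t) (mulrA (3 * (a * V) ^+ 2)%R) lexx.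
have mcube := measurable_cube R d.
rewrite expr0 mul1r (run_integral0 mbad bad0).
apply: (@le_trans _ _ ((a * a * V)%:E * mu (cube R d))); last by rewrite cube1 mule1.
apply: le_trans (pois_int_pairs_le mcube cube_fin).
apply: (le_pois_int a0 mu1 mcube).
- exact: (iffLR (measurable_configurationP _) mbad).
- have := @cmeas_sum _ _ meq R _ unit (fun p P => cnt p.2 (P `\ p.2)%fset).
  move=> /(_ _)/(pmeas_smeas tt); apply.
  apply: (cmeas_D1 meq (f := fun (p : unit * E) P => cnt p.2 P)).
  exact: (cmeas_comp (h := snd) _ mcnt).
- by move=> s; exact: bad0.
- by move=> s; exact: sume_ge0.
move=> s _ _; rewrite /bad.
apply: (@le_trans _ _ (\sum_(x <- fset_of_seq s)
    count (nearby r x) (fset_of_seq s `\ x)%fset)%:R%:E).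
  by rewrite lee_fin ler_nat card_bad_points_le.
rewrite natr_sum -sumEFin.
by under eq_bigr do rewrite countE.
Qed.

End invariant.

(** * Volumes of balls in Euclidean space *)

Section euclidean_volume.
Context (R : realType).
Local Notation leb := (@lebesgue_measure R).
Local Notation T := (measurableTypeR R).
Variable rho : R.
Hypothesis rho0 : (0 < rho)%R.

Let rescale (c t : R) : R := ((t - c) / rho)%R.

Let mrescale c : measurable_fun [set: T] (rescale c : T -> T).
Proof. by apply: measurable_funM => //; exact: measurable_funB. Qed.

(** Divided by [rho], the image measure agrees with Lebesgue measure on half-open intervals, which
    determine it. *)
Lemma lebesgue_measure_rescale (c : R) (A : set T) : measurable A ->
  pushforward leb (rescale c : T -> T) A = rho%:E * leb A.
Proof.
move=> mA.
have ri0 : (0 <= rho^-1)%R by rewrite invr_ge0 ltW.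
pose m1 := measure_function_pushforward__canonical__measure_function_Measure
  leb (mrescale c).
pose m2 := mscale (NngNum ri0) m1.
have := @lebesgue_measure_unique R m2.
move=> /(_ _ A mA) ->.
  by rewrite /m2 /m1 /mscale/= muleA -EFinM divff ?mul1e// gt_eqF.
move=> _ [[u v] _ <-]; change (leb `]u, v]%classic = rho^-1%:E * leb (rescale c @^-1` `]u, v]%classic)).
rewrite (_ : _ @^-1` _ = `](rho * u + c)%R, (rho * v + c)%R]%classic); last first.
  apply/seteqP; split => t; rewrite /= !in_itv/= /rescale => /andP[];
    rewrite ?ltr_pdivlMr ?ler_pdivrMr// => *; apply/andP; split;
    rewrite ?ltr_pdivlMr ?ler_pdivrMr//; lra.
rewrite !lebesgue_measure_itv/= !lte_fin ltrD2r ltr_pM2l//.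
case: ifPn => _; last by rewrite mule0.
by rewrite -EFinM -!EFinB; congr EFin; field; rewrite gt_eqF.
Qed.

Lemma ge0_integral_rescale (c : R) (f : T -> \bar R) :
  measurable_fun setT f -> (forall x, 0 <= f x) ->
  \int[leb]_x f (rescale c x) = rho%:E * \int[leb]_x f x.
Proof.
move=> mf f0.
have r0 : (0 <= rho)%R by rewrite ltW.
rewrite -[RHS](@ge0_integral_mscale _ _ _ leb _ measurableT (NngNum r0))//.
rewrite -[LHS](@ge0_integral_pushforward _ _ _ _ _ _ (mrescale c) leb setT f)//.
by apply: eq_measure_integral => A mA _; exact: lebesgue_measure_rescale.
Qed.

(** Missing coordinates of the centre [c] count as 0, so [c] needs no length constraint in the
    inductions. *)
Fixpoint rescale_seq (c s : seq R) : seq R :=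
  if s is x :: s' then rescale (head 0%R c) x :: rescale_seq (behead c) s' else [::].

Lemma pmeas_rescale_seq dZ (Z : measurableType dZ) dU (U : measurableType dU)
    (f : Z -> seq T -> U) c :
  pmeas f -> pmeas (fun z s => f z (rescale_seq c s)).
Proof.
move=> mf n; elim: n dZ Z f c mf => [|n IHn] dZ Z f c mf.
  apply: (eq_measurable_fun (fun q => f q.1 [::])) => [[z q] _ /=|].
    by rewrite (tuple0 q).
  by apply: (measurable_comp_fun (g := f^~ [::])) => //; exact: pmeas_nil.
apply: (measurable_uncons (f := fun z s => f z (rescale_seq c s))) => /=.
apply: (IHn _ (Z * T)%type (fun z s => f z.1 (rescale (head 0%R c) z.2 :: s))).
have mh : measurable_fun setT (fun z : Z * T => (z.1, rescale (head 0%R c) z.2 : T)).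
  apply: measurable_fun_pair => //=.
  exact: (measurable_comp_fun (mrescale (head 0%R c))).
exact: (pmeas_comp mh (pmeas_cons mf)).
Qed.

Lemma iint_rescale n c (phi : seq T -> \bar R) :
  smeas phi -> (forall s, 0 <= phi s) ->
  iint leb setT n (fun s => phi (rescale_seq c s)) =
  (rho ^+ n)%:E * iint leb setT n phi.
Proof.
elim: n c phi => [|n IHn] c phi mphi phi0 /=; first by rewrite mul1e.
have mi := measurable_iint_cons leb n measurableT mphi phi0.
transitivity (\int[leb]_x ((rho ^+ n)%:E *
    iint leb setT n (fun s => phi (rescale (head 0%R c) x :: s)))).
  apply: eq_integral => x _.
  by rewrite -(IHn (behead c) (fun s => phi (rescale (head 0%R c) x :: s)))//; exact: smeas_head.
rewrite (@ge0_integral_rescale _ (fun x => (rho ^+ n)%:E * iint leb setT n (fun s => phi (x :: s)))); last 2 first.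
- exact: measurable_funeM.
- by move=> x; rewrite mule_ge0 ?iint_ge0// lee_fin exprn_ge0// ltW.
rewrite ge0_integralZl ?lee_fin ?exprn_ge0 ?ltW//; last by move=> x _; exact: iint_ge0.
by rewrite muleA -EFinM exprS.
Qed.

End euclidean_volume.

Section unit_ball.
Context (R : realType).
Local Notation leb := (@lebesgue_measure R).
Local Notation T := (measurableTypeR R).

Lemma smeas_sum_sqr : smeas (fun s : seq T => (\sum_(t <- s) (t : R) ^+ 2)%R : R).
Proof.
move=> n; apply: (eq_measurable_fun (fun q : n.-tuple T => \sum_(i < n) (tnth q i : R) ^+ 2)%R).
  by move=> q _; rewrite [in RHS]big_tuple.
by apply: measurable_sum => i; apply: measurable_funX; exact: measurable_tnth.
Qed.

Let ball_ind (s : seq T) : \bar R := (\sum_(t <- s) (t : R) ^+ 2 <= 1)%R%:R%:E.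

Let ball_ind0 s : 0 <= ball_ind s. Proof. by rewrite lee_fin. Qed.

Let smeas_ball_ind : smeas ball_ind.
Proof.
move=> n.
apply: (eq_measurable_fun (fun q : n.-tuple T =>
    if (\sum_(t <- q) (t : R) ^+ 2 <= 1)%R then 1 else 0)) => [q _|].
  by rewrite /ball_ind; case: leP.
by apply: measurable_fun_ifT => //; apply: measurable_fun_ler => //; exact: smeas_sum_sqr.
Qed.

Lemma enorm_tuple d (x : euclid R d) :
  enorm x = Num.sqrt (\sum_(t <- x) (t : R) ^+ 2)%R.
Proof. by rewrite /enorm big_tuple. Qed.

Lemma enorm_le1 d (x : euclid R d) :
  (enorm x <= 1)%R = (\sum_(t <- x) (t : R) ^+ 2 <= 1)%R.
Proof.
rewrite enorm_tuple -(@ler_sqr _ (Num.sqrt _)) ?nnegrE ?sqrtr_ge0// sqr_sqrtr ?expr1n//.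
by apply: sumr_ge0 => t _; exact: sqr_ge0.
Qed.

Lemma measurable_unit_ball d : measurable [set x : euclid R d | (enorm x <= 1)%R].
Proof.
rewrite (_ : [set _ | _] = (fun x : euclid R d => \sum_(t <- x) (t : R) ^+ 2)%R @^-1` `]-oo, 1%R]).
  by rewrite -[X in measurable X]setTI; exact: smeas_sum_sqr.
by apply/seteqP; split => x /=; rewrite in_itv/= enorm_le1.
Qed.

Lemma unit_ball_iint d : volume R d [set x | (enorm x <= 1)%R] = iint leb setT d ball_ind.
Proof.
rewrite -power_measure_integral// -[LHS]mul1e -(setIT [set x | _]).
rewrite -[LHS]/(1 * volume R d _) mul1e -integral_indic//; last exact: measurable_unit_ball.
apply: eq_integral => x _; rewrite indicE /ball_ind -enorm_le1.
by congr (_%:R%:E); congr nat_of_bool; apply/idP/idP; rewrite inE.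
Qed.

Lemma measurable_box d (I : set T) : measurable I ->
  measurable [set x : euclid R d | forall i, I (tnth x i)].
Proof.
move=> mI; rewrite (_ : [set _ | _] = \bigcap_(i in [set: 'I_d])
    ((fun z : euclid R d => tnth z i) @^-1` I)).
  apply: fin_bigcap_measurable => [|i _]; first exact: finite_finset.
  by rewrite -[X in measurable X]setTI; exact: measurable_tnth.
by apply/seteqP; split => z /= h i //=; exact: h.
Qed.

Lemma volume_box d (I : set T) (l : R) : measurable I -> leb I = l%:E ->
  volume R d [set x | forall i, I (tnth x i)] = (l ^+ d)%:E.
Proof.
move=> mI Il; elim: d => [|d IHd].
  rewrite (_ : [set _ | _] = setT); first by rewrite expr0; exact: diracT.
  by apply/seteqP; split => // x _ [].
transitivity ((leb \x volume R d) (I `*` [set x | forall i, I (tnth x i)])).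
  congr ((leb \x volume R d) _).
  apply/seteqP; split => -[x y] /=.
    move=> h; split; first by have := h ord0; rewrite tnth0.
    by move=> i; have := h (lift ord0 i); rewrite tnthS.
  move=> [Ix Iy] i; case: (unliftP ord0 i) => [j ->|->]; last by rewrite tnth0.
  by rewrite tnthS.
rewrite product_measure1E//; last exact: measurable_box.
by rewrite [X in X * _]Il [X in _ * X]IHd -EFinM exprS.
Qed.

Lemma volume_cube d : volume R d (cube R d) = 1.
Proof.
rewrite (_ : cube R d = [set x | forall i, `[0%R, 1%R]%classic (tnth x i)]).
  by rewrite (volume_box d (l := 1%R)) ?expr1n//= lebesgue_measure_itv/= lte_fin ltr01 oppr0 adde0.
by apply/seteqP; split => x /= h i; have := h i; rewrite /= in_itv.
Qed.

Lemma measurable_set1_tuple d (x : euclid R d) : measurable [set x].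
Proof.
rewrite (_ : [set x] = \bigcap_(i in [set: 'I_d])
    ((fun z : euclid R d => tnth z i) @^-1` [set tnth x i])).
  apply: fin_bigcap_measurable => [|i _]; first exact: finite_finset.
  rewrite -[X in measurable X]setTI.
  exact: (measurable_tnth i measurableT (measurable_set1 (tnth x i : R))).
apply/seteqP; split => z /=; first by move=> ->.
by move=> h; apply: eq_from_tnth => i; exact: h.
Qed.

(** The first coordinate alone already makes the point null. In dimension 0 the space is a single
    atom of mass 1. *)
Lemma volume_set1 d (x : euclid R d) : (0 < d)%N ->
  measurable [set x] /\ volume R d [set x] = 0.
Proof.
move=> d0; split; first exact: measurable_set1_tuple.
case: d d0 x => // d _ x.
transitivity ((leb \x volume R d) ([set thead x] `*` [set [tuple of behead x]])).
  congr ((leb \x volume R d) _); apply/seteqP; split => -[y z] /=.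
    by move=> <-; split => //; exact: val_inj.
  by move=> [-> ->]; rewrite [RHS]tuple_eta; exact: val_inj.
rewrite product_measure1E//; last exact: measurable_set1_tuple.
by rewrite [X in X * _](lebesgue_measure_set1 (thead x)) mul0e.
Qed.

(** The ball lies in the box with all coordinates between -1 and 1. *)
Lemma unit_ball_fin d : volume R d [set x | (enorm x <= 1)%R] < +oo.
Proof.
have mI : measurable (`[(-1)%R, 1%R]%classic : set T) by [].
apply: (@le_lt_trans _ _ (volume R d [set x | forall i, `[(-1)%R, 1%R]%classic (tnth x i)])).
  apply: le_measure; rewrite ?inE; [exact: measurable_unit_ball|exact: measurable_box|].
  move=> x /=; rewrite enorm_le1 big_tuple => h i; rewrite in_itv/= -ler_norml.
  rewrite -(@ler_sqr _ `|_|%R) ?nnegrE// expr1n real_normK ?num_real//.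
  apply: le_trans h; rewrite (bigD1 i)//= lerDl.
  by apply: sumr_ge0 => j _; exact: sqr_ge0.
rewrite (volume_box d (l := 2%R))//= ?ltry//.
rewrite lebesgue_measure_itv/= lte_fin ifT; last by lra.
by rewrite -EFinB; congr EFin; lra.
Qed.

(** The ball contains the box with all coordinates between 0 and [1/d]: each square is at most
    [1/d], hence their sum is at most 1. *)
Lemma unit_ball_gt0 d : (0 < d)%N -> (0 < unit_ball_volume R d)%R.
Proof.
move=> d0; rewrite /unit_ball_volume fine_gt0// unit_ball_fin andbT.
pose e : R := (d%:R^-1)%R.
have e0 : (0 < e)%R by rewrite invr_gt0 ltr0n.
have mI : measurable (`[0%R, e]%classic : set T) by [].
apply: (@lt_le_trans _ _ (volume R d [set x | forall i, `[0%R, e]%classic (tnth x i)])).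
  rewrite (volume_box d (l := e))//=; first by rewrite lte_fin exprn_gt0.
  by rewrite lebesgue_measure_itv/= lte_fin e0 oppr0 adde0.
apply: le_measure; rewrite ?inE; [exact: measurable_box|exact: measurable_unit_ball|].
move=> x /= h; rewrite enorm_le1 big_tuple.
apply: (@le_trans _ _ (\sum_(i < d) e)%R).
  apply: ler_sum => i _; have := h i; rewrite in_itv/= => /andP[xi0 xie].
  have e1 : (e <= 1)%R by rewrite invf_le1 ?ltr0n// ler1n.
  rewrite expr2; apply: le_trans (ler_wpM2l xi0 xie) _.
  by rewrite ler_piMl// ?(le_trans xie)// ltW.
by rewrite sumr_const card_ord /e -[X in (X <= _)%R]mulr_natr mulVf// pnatr_eq0 -lt0n.
Qed.

Lemma sum_sqr_rescale_seq (rho : R) (c s : seq R) :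
  (\sum_(t <- rescale_seq rho c s) t ^+ 2 =
   (\sum_(i < size s) (s`_i - c`_i) ^+ 2) / rho ^+ 2)%R.
Proof.
elim: s c => [|x s IHs] c /=; first by rewrite big_nil big_ord0 mul0r.
rewrite big_cons big_ord_recl/= IHs [RHS]mulrDl nth0 -expr_div_n. congr (_ + _ / _)%R.
by apply: eq_bigr => i _; rewrite nth_behead.
Qed.

(** Translation and scaling carry the open ball into the closed unit ball, whose volume defines
    [unit_ball_volume]. The inclusion gives the upper bound, which is the direction that [V] has to
    satisfy. *)
Lemma volume_open_ball_le d (x : euclid R d) (rho : R) : (0 < rho)%R ->
  volume R d (open_ball x rho) <= (unit_ball_volume R d * rho ^+ d)%:E.
Proof.
move=> rho0; have r0 : (rho != 0)%R by rewrite gt_eqF.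
rewrite EFinM muleC /unit_ball_volume fineK; last by rewrite ge0_fin_numE ?unit_ball_fin.
rewrite unit_ball_iint -(iint_rescale rho0 d x)// -power_measure_integral//; last first.
  have := pmeas_rescale_seq rho x (smeas_pmeas (Z := unit) smeas_ball_ind).
  exact: (pmeas_smeas tt).
rewrite -[leLHS]mul1e -(setIT (open_ball x rho)) -[leLHS]/(1 * volume R d _) mul1e.
rewrite -integral_indic//; last exact: measurable_open_ball.
apply: ge0_le_integral => //.
- by apply/measurable_EFinP; apply: measurable_indic; exact: measurable_open_ball.
- have := pmeas_rescale_seq rho x (smeas_pmeas (Z := unit) smeas_ball_ind).
  by move=> /(pmeas_smeas tt) /(_ d).
move=> z _; rewrite indicE; case: (boolP (z \in _)) => [|_]; last by rewrite lee_fin.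
rewrite inE /open_ball /= => zx; rewrite /ball_ind lee_fin.
suff -> : (\sum_(t <- rescale_seq rho x z) t ^+ 2 <= 1)%R by [].
rewrite sum_sqr_rescale_seq ler_pdivrMr ?exprn_gt0// mul1r size_tuple.
move: zx; rewrite /Defs.edist /enorm => zx.
have -> : (\sum_(i < d) ((z : seq R)`_i - (x : seq R)`_i) ^+ 2 =
    Num.sqrt (\sum_(i < d) (tnth (tsub z x) i : R) ^+ 2) ^+ 2)%R.
  rewrite sqr_sqrtr; last by apply: sumr_ge0 => i _; exact: sqr_ge0.
  by apply: eq_bigr => i _; rewrite tnth_mktuple !(tnth_nth 0%R).
by rewrite ler_sqr ?nnegrE ?sqrtr_ge0 1?ltW.
Qed.

End unit_ball.

(** * Packing density and number of iterations *)

Section packing.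
Context (R : realType) (d : nat) (lambda r : R).
Local Notation E := (euclid R d).
Local Notation a := (intensity d lambda r).
Local Notation mu := (volume R d).
Local Notation hc := (hard_core r).
Local Notation PP := (poisson_process mu a (measurable_cube R d)).
Implicit Types (P Q : {fset E}) (x y z : E).
Hypothesis a0 : (0 <= a)%R.
Hypothesis mu1 : forall x : E, measurable [set x] /\ mu [set x] = 0.
Hypothesis cube1 : mu (cube R d) = 1.
Variable V : R.
Hypothesis V0 : (0 <= V)%R.
Hypothesis ballV : forall x, mu (open_ball x (2 * r)) <= V%:E.

Let cube_fin : mu (cube R d) < +oo. Proof. by rewrite cube1 ltry. Qed.
Let mcube : measurable (cube R d). Proof. exact: measurable_cube. Qed.
Local Notation meq := (@measurable_eq_euclid R d).

Let h P : \bar R := (\1_hc P)%:E.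
Let h0 P : 0 <= h P. Proof. by rewrite lee_fin. Qed.
Let mh : measurable_fun setT h.
Proof. by apply/measurable_EFinP; apply: measurable_indic; exact: measurable_hard_core. Qed.

Let hE P : h P = if `[< hc P >] then 1 else 0.
Proof.
rewrite /h indicE; case: asboolP => hP; first by rewrite mem_set.
by rewrite memNset.
Qed.

Let F y P := h (y |` P)%fset.
Let F0 y P : 0 <= F y P. Proof. exact: h0. Qed.
Let mF : cmeas F.
Proof.
have := smeas_cons (iffLR (measurable_configurationP h) mh).
move=> H n; have := H n; apply: eq_measurable_fun => -[y q] _ /=.
by congr h; apply/fsetP => x; rewrite in_fset1U !mem_fset_of_seq inE.
Qed.

Let ind x y : \bar R := (nearby r x y)%:R%:E.
Let ind0 x y : 0 <= ind x y. Proof. by rewrite lee_fin. Qed.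
Let mind : measurable_fun [set: (E * E)%type] (fun p => ind p.1 p.2).
Proof. exact: (measurable_indicator (@measurable_nearby R d r)). Qed.
Let indC x y : ind x y = ind y x. Proof. by rewrite /ind nearbyC. Qed.

Let H y P : \bar R := h P * \sum_(x <- P) ind y x.
Let H0 y P : 0 <= H y P. Proof. by rewrite mule_ge0// sume_ge0. Qed.
Let mH : cmeas H.
Proof.
have m1 : cmeas (fun y P => \sum_(x <- P) ind y x).
  apply: (cmeas_sum meq (g := fun p _ => ind p.1 p.2)).
  exact: (cmeas_param (g := fun p : E * E => ind p.1 p.2)).
move=> n; apply: emeasurable_funM; last exact: (m1 n).
have m2 : cmeas (fun _ : E => h) by exact: (measurable_cmeas mh).
exact: (m2 n).
Qed.

(** Adding [y] to a hard-core configuration keeps it hard-core unless [y] is near one of its points,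
    and then the sum in [H] is at least 1. *)
Let h_le y P : h P <= F y P + H y P.
Proof.
rewrite /F /H !hE; case: asboolP => hP; last by rewrite mul0e adde0; case: ifP.
rewrite mul1e; case: asboolP => hyP; first by rewrite leeDl// sume_ge0.
rewrite add0e; have [/hasP[x xP yx]|nP] := boolP (has (nearby r y) P).
  rewrite (big_fsetD1 x)//= /ind yx leeDl//.
  exact: sume_ge0.
exfalso; apply: hyP; apply/bad_pairs_eq0 => u v.
have {}hP := iffLR (bad_pairs_eq0 _ _) hP.
rewrite !in_fset1U => /orP[/eqP->|uP] /orP[/eqP->|vP]; rewrite ?eqxx// => uv.
- by move/hasPn : nP => /(_ _ vP).
- by move/hasPn : nP => /(_ _ uP); rewrite nearbyC.
- exact: hP.
Qed.

(** [Z] is the partition function of the hard spheres model, and [N / Z] its mean number of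
    points. *)
Let N := pois_int mu a (cube R d) (fun s => #|` fset_of_seq s|%:R%:E * h (fset_of_seq s)).
Let Z := pois_int mu a (cube R d) (fun s => h (fset_of_seq s)).

(** Removing [y] and putting it back brings the number of points into the form that Mecke's formula
    requires. *)
Let card_sum P : #|` P|%:R%:E * h P = \sum_(y <- P) F y (P `\ y)%fset.
Proof.
rewrite (eq_big_seq (fun=> h P)); last by move=> y yP; rewrite /F fsetD1K.
rewrite -[X in X%:R]sum1_size natr_sum -sumEFin ge0_sume_distrl//.
by apply: eq_bigr => y _; rewrite mul1e.
Qed.

Let mcard : measurable_fun setT (fun P => #|` P|%:R%:E * h P).
Proof.
rewrite (_ : (fun _ => _) = fun P => \sum_(y <- P) F y (P `\ y)%fset); last first.
  by apply/funext => P; exact: card_sum.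
apply: (cmeas_measurable (f := fun _ : unit => fun P => \sum_(y <- P) F y (P `\ y)%fset) tt).
apply: (cmeas_sum meq (g := fun (p : unit * E) P => F p.2 (P `\ p.2)%fset)).
apply: (cmeas_D1 meq (f := fun (p : unit * E) P => F p.2 P)).
exact: (cmeas_comp (h := snd) _ mF).
Qed.

Let NE : N = a%:E * \int[mu]_(y in cube R d) pois_int mu a (cube R d) (fun s => F y (fset_of_seq s)).
Proof.
rewrite -(mecke a0 meq mu1 mcube cube_fin mF F0) /N.
by congr pois_int; apply/funext => s; exact: card_sum.
Qed.

Let mpois (G : E -> {fset E} -> \bar R) : cmeas G -> (forall y P, 0 <= G y P) ->
  measurable_fun setT (fun y => pois_int mu a (cube R d) (fun s => G y (fset_of_seq s))).
Proof.
move=> mG G0; apply: (@measurable_pois_int _ _ _ _ _ a0 _ _ (fun=> cube R d)) => //.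
exact: measurable_const_section.
Qed.

(** [h_le] is averaged over [y] in the cube and over the Poisson process. Multiplied by [a], the [F]
    part is [N] by Mecke's formula; the [H] part is at most [V * N], since each point blocks a
    volume at most [V]. *)
Lemma partition_le_card : a%:E * Z <= (1 + a * V)%:E * N.
Proof.
have N0 : 0 <= N by apply: pois_int_ge0 => // s; exact: mule_ge0.
have smh : smeas (fun s => h (fset_of_seq s)) by exact: (iffLR (measurable_configurationP h) mh).
have Z0 : 0 <= Z by exact: pois_int_ge0.
have hH : \int[mu]_(y in cube R d) pois_int mu a (cube R d) (fun s => H y (fset_of_seq s)) <= V%:E * N.
  have mHi := measurable_cmeas_cube_integral mH H0.
  have Hi0 P : 0 <= \int[mu]_(y in cube R d) H y P by exact: integral_ge0.
  rewrite -pois_int_integral//.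
  rewrite -(poisson_process_integral a0 mcube (f := fun P => \int[mu]_(y in cube R d) H y P))//.
  rewrite /N -(poisson_process_integral a0 mcube (f := fun P => #|` P|%:R%:E * h P))//; last first.
    by move=> P; exact: mule_ge0.
  rewrite -ge0_integralZl//; last by move=> P _; exact: mule_ge0.
  apply: ge0_le_integral => //; first exact: measurable_funeM.
  move=> P _; rewrite /H ge0_integralZl//; last 2 first.
  - apply: emeasurable_sum => x; rewrite (_ : ind^~ x = ind x).
      by apply: measurable_funTS; exact: (measurable_comp_fun mind (pair1_measurable x)).
    by apply/funext => y; exact: indC.
  - by move=> y _; exact: sume_ge0.
  rewrite muleA [leRHS]muleC; apply: lee_wpmul2l => //.
  rewrite ge0_integral_sum//; last first.
    move=> x; rewrite (_ : ind^~ x = ind x).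
      by apply: measurable_funTS; exact: (measurable_comp_fun mind (pair1_measurable x)).
    by apply/funext => y; exact: indC.
  apply: (@le_trans _ _ (\sum_(x <- P) V%:E)).
    apply: lee_sum => x _; apply: le_trans (nearby_integral_le ballV x mcube).
    rewrite le_eqVlt; apply/orP; left; apply/eqP.
    by apply: eq_integral => y _; exact: indC.
  by rewrite sumEFin big_const_seq count_predT iter_addr_0 -EFinM lee_fin mulr_natr.
have hZ : Z <= \int[mu]_(y in cube R d) pois_int mu a (cube R d) (fun s => F y (fset_of_seq s)) +
    \int[mu]_(y in cube R d) pois_int mu a (cube R d) (fun s => H y (fset_of_seq s)).
  rewrite -ge0_integralD//; last 4 first.
  - by move=> y _; exact: pois_int_ge0.
  - by apply: measurable_funTS; exact: mpois.
  - by move=> y _; exact: pois_int_ge0.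
  - by apply: measurable_funTS; exact: mpois.
  rewrite -[leLHS]mule1 -cube1 -integral_cst//; apply: ge0_le_integral => //.
  - apply: emeasurable_funD.
      by apply: measurable_funTS; exact: mpois.
    by apply: measurable_funTS; exact: mpois.
  - move=> y _; rewrite -pois_intD//; [|exact: (pmeas_smeas y mF)|exact: (pmeas_smeas y mH)].
    apply: (le_pois_int a0 mu1) => //.
    + have sF : smeas _ := pmeas_smeas y mF.
      have sH : smeas _ := pmeas_smeas y mH.
      by move=> n; exact: (emeasurable_funD (sF n) (sH n)).
    + by move=> s; exact: adde_ge0.
apply: (@le_trans _ _ (N + a%:E * (V%:E * N))).
  apply: le_trans (lee_wpmul2l _ hZ) _ => //.
  rewrite [leLHS]ge0_muleDr; [|by apply: integral_ge0 => y _; exact: pois_int_ge0..].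
  by rewrite -NE leeD2l// lee_wpmul2l.
have aV0 : (0 <= a * V)%R by exact: mulr_ge0.
by rewrite EFinD [leRHS]ge0_muleDl ?lee_fin// mul1e (EFinM a V) muleA.
Qed.

(** The empty configuration is hard-core, so the term of length zero in the series is 1. *)
Lemma partition_gt0 : 0 < Z.
Proof.
rewrite /Z /pois_int mule_gt0 ?lte_fin ?expR_gt0//.
apply: (@lt_le_trans _ _ 1) => //.
apply: le_trans (nneseries_lim_ge 1 _) => [|k _ _]; last first.
  by rewrite mule_ge0 ?iint_ge0// lee_fin divr_ge0// exprn_ge0.
rewrite big_nat1 expr0 divr1 mul1e /= hE ifT//; apply/asboolP.
by apply/bad_pairs_eq0 => x y; rewrite mem_fset_of_seq.
Qed.

Lemma packing_density_ge : (0 <= unit_ball_volume R d * r ^+ d)%R ->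
  (unit_ball_volume R d * r ^+ d * (a / (1 + a * V)))%:E <= packing_density d lambda r.
Proof.
move=> v0; rewrite EFinM; apply: lee_wpmul2l; first by rewrite lee_fin.
have mhc := @measurable_hard_core R d r.
have ZE : Z = PP hc.
  rewrite /Z -(poisson_process_integral a0 (measurable_cube R d) (f := h))//.
  by rewrite integral_indic// setIT.
have Zfin : Z \is a fin_num by rewrite ZE; exact: fin_num_measure.
have z0 : (0 < fine Z)%R by rewrite fine_gt0// partition_gt0 ltey_eq Zfin.
have zi0 : (0 <= (fine Z)^-1)%R by rewrite invr_ge0 ltW.
have mN : measurable_fun setT (fun P : {fset E} => (#|` P|%:R)%:E : \bar R).
  rewrite (_ : (fun _ => _) = fun P => \sum_(y <- P) 1); last first.
    by apply/funext => P; rewrite sumEFin big_const_seq count_predT iter_addr_0.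
  apply: (cmeas_measurable (f := fun _ : unit => fun P => \sum_(y <- P) 1) tt).
  exact: (cmeas_sum meq (g := fun (p : unit * E) P => 1)).
have hs : \int[hard_spheres d lambda r]_P (#|` P|%:R)%:E = ((fine Z)^-1)%:E * N.
  rewrite /N -(poisson_process_integral a0 (measurable_cube R d) (f := fun P => #|` P|%:R%:E * h P))//; last first.
    by move=> P; exact: mule_ge0.
  transitivity (((fine Z)^-1)%:E * \int[mrestr PP mhc]_P (#|` P|%:R)%:E).
    rewrite -(@ge0_integral_mscale _ _ _ _ _ measurableT (NngNum zi0))//.
    apply: eq_measure_integral => A mA _.
    rewrite /= /hard_spheres/= /mnormalize /= /mrestr setTI -ZE.
    rewrite gt_eqF ?partition_gt0//= lt_eqF ?ltey_eq ?Zfin//=.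
    by rewrite /mscale/= muleC.
  congr (_ * _); rewrite ge0_integral_mrestr// integral_mkcond.
  apply: eq_integral => P _; rewrite /patch hE; case: ifPn => [/set_mem hP|/negP hP].
    by rewrite asboolT// mule1.
  by rewrite asboolF ?mule0// => /mem_set.
rewrite hs; have := partition_le_card; rewrite -(fineK Zfin) -/N => hN.
have aV1 : (0 < 1 + a * V)%R by rewrite ltr_pwDl// mulr_ge0.
have c0 : (0 <= (1 + a * V)^-1 * (fine Z)^-1)%R by rewrite mulr_ge0// invr_ge0 ltW.
have := @lee_wpmul2l _ ((1 + a * V)^-1 * (fine Z)^-1)%:E _ _ _ hN.
rewrite lee_fin => /(_ c0); rewrite -(EFinM a) muleA -!EFinM.
rewrite (_ : (_ * (a * fine Z) = a / (1 + a * V))%R); last first.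
  by field; rewrite !gt_eqF.
by rewrite (_ : (_ * (1 + a * V) = (fine Z)^-1)%R)//; field; rewrite !gt_eqF.
Qed.

End packing.

(** * From the decay of the bad points to the number of iterations *)

Section iteration_count.
Context (R : realType) (d : nat) (r : R).
Local Notation E := (euclid R d).
Variables (d' : measure_display) (Omega : measurableType d').
Variables (Pr : probability Omega R) (X : nat -> Omega -> {fset E}).

Let u t w : \bar R := (bad_points r (X t w) != fset0)%:R%:E.
Let u0 t w : 0 <= u t w. Proof. by rewrite lee_fin. Qed.

(** Every term before the first time without bad points equals 1; if there is no such time, the
    series diverges. *)
Lemma iterations_le_sum w : iterations r X w <= \sum_(t <oo) u t w.
Proof.
have [[t0 ht0]|nt] := pselect (exists t, bad_points r (X t w) == fset0); last first.
  rewrite (_ : \sum_(t <oo) u t w = +oo) ?leey//.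
  apply/eqyP => A A0.
  apply: le_trans (nneseries_lim_ge (Num.truncn A).+1 _) => //.
  rewrite (eq_bigr (fun=> 1)) => [|t _]; last first.
    by rewrite /u; case: eqP => // /eqP ht; exfalso; apply: nt; exists t.
  rewrite sumEFin sumr_const_nat subn0 lee_fin.
  by rewrite ltW// truncnS_gt.
have ex : exists t, bad_points r (X t w) == fset0 by exists t0.
case: (ex_minnP ex) => t /eqP ht tmin.
apply: (@le_trans _ _ t%:R%:E).
  by apply: ereal_inf_lbound; exists t.
apply: le_trans (nneseries_lim_ge t _) => //.
rewrite (eq_big_nat _ _ (F2 := fun=> 1)) => [|s /andP[_ st]]; last first.
  by rewrite /u; case: eqP => // /eqP hs; move: st; rewrite ltnNge tmin.
by rewrite sumEFin sumr_const_nat subn0.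
Qed.

Hypothesis mu_ : forall t, measurable_fun setT (u t).

(* [iterations r X] is not assumed measurable; its integral is a supremum over
   the simple functions below it, which is monotone anyway. *)
Lemma integral_iterations_le :
  \int[Pr]_w iterations r X w <= \sum_(t <oo) \int[Pr]_w u t w.
Proof.
rewrite -integral_nneseries//.
rewrite !ge0_integralTE; last 2 first.
- by move=> w; apply: le_ereal_inf_tmp => _ [t _ <-]; rewrite lee_fin.
- by move=> w; apply: nneseries_ge0 => t _ _; exact: u0.
apply: ereal_sup_le => _ [g hg <-]; exists g => // w.
by apply: le_trans (hg w) (iterations_le_sum w).
Qed.

End iteration_count.

(** The first [n] terms are bounded by 1. By the choice of [n], the geometric bound has dropped
    below 1 at that point, so the tail is at most [(1 - q)^-1]. *)
Lemma nneseries_geometric_le (R : realType) (e : nat -> R) (q A : R) (n : nat) :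
  (0 <= q < 1)%R -> (forall t, 0 <= e t <= 1)%R ->
  (forall t, e t <= q ^+ t * A)%R -> (q ^+ n * A <= 1)%R ->
  \sum_(t <oo) (e t)%:E <= (n%:R + (1 - q)^-1)%:E.
Proof.
move=> /andP[q0 q1] e01 eA qn.
have e0 t : 0 <= (e t)%:E :> \bar R by rewrite lee_fin; case/andP: (e01 t).
rewrite (nneseries_split _ n)// add0n EFinD; apply: leeD.
  rewrite big_mkord sumEFin lee_fin.
  apply: (@le_trans _ _ (\sum_(i < n) 1)%R).
    by apply: ler_sum => t _; case/andP: (e01 t).
  by rewrite sumr_const card_ord.
rewrite -nneseries_addn//; apply: lime_le.
  by apply: is_cvg_nneseries => k _ _.
apply: nearW => m; rewrite sumEFin lee_fin.
have q10 : (0 < 1 - q)%R by rewrite subr_gt0.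
apply: (@le_trans _ _ (\sum_(0 <= t < m) q ^+ t)%R).
  apply: ler_sum => t _; apply: le_trans (eA _) _.
  by rewrite exprD -mulrA ler_piMr// exprn_ge0.
rewrite -[leRHS]mul1r ler_pdivlMr// big_mkord.
have -> : ((\sum_(i < m) q ^+ i) * (1 - q) = 1 - q ^+ m)%R.
  by rewrite -[RHS]opprB subrX1 -mulNr opprB mulrC.
by rewrite lerBlDr lerDl exprn_ge0.
Qed.

Lemma geometric_time_le_log (R : realType) (D : R) (d : nat) : (0 < D)%R ->
  exists2 C : R, (0 < C)%R & forall r : R, (0 < r <= expR (-1))%R ->
  exists2 n : nat, ((3 / 4) ^+ n * (D / r ^+ d) <= 1)%R & (n%:R + 4 <= C * ln (1 / r))%R.
Proof.
move=> D0; pose l : R := ln (4 / 3)%R.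
have l0 : (0 < l)%R by rewrite ln_gt0//; lra.
have M0 : (0 <= (`|ln D| + d%:R) / l)%R by rewrite divr_ge0 ?addr_ge0// ltW.
(* The bound [expR (-1)] on [r] gives [1 <= ln (1 / r)], so the 5 absorbs the 4 of the conclusion
   and the 1 lost in rounding up. *)
exists ((`|ln D| + d%:R) / l + 5)%R; first by rewrite ltr_wpDl.
move=> r /andP[r0 re].
have L1 : (1 <= ln (1 / r))%R.
  rewrite div1r lnV ?posrE// lerNr -[leRHS]expRK.
  by rewrite ler_ln ?posrE ?expR_gt0.
set L := ln (1 / r)%R in L1 *.
have L0 : (0 <= L)%R by rewrite (le_trans _ L1).
(* As [1 <= L], the product [M * l] is at least [ln D + d * L], the logarithm of [D / r ^+ d]. *)
pose M := ((`|ln D| + d%:R) / l * L)%R.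
have ML0 : (0 <= M)%R by rewrite mulr_ge0.
exists (Num.truncn M).+1; last first.
  rewrite -natr1 mulrDl -/M.
  have h (x y z : R) : (x <= y -> 1 <= z -> x + 1 + 4 <= y + 5 * z)%R by move=> *; lra.
  by apply: h => //; rewrite truncn_le.
have rd0 : (0 < r ^+ d)%R by rewrite exprn_gt0.
have p43 : (0 < 4 / 3 :> R)%R by lra.
have q0 : (0 < (4 / 3 : R) ^+ (Num.truncn M).+1)%R by rewrite exprn_gt0.
rewrite (_ : (3 / 4 : R) = (4 / 3)^-1)%R; last by field.
rewrite exprVn mulrC ler_pdivrMr// mul1r -ler_ln ?posrE//; last by rewrite divr_gt0.
rewrite lnM ?posrE ?invr_gt0// lnV ?posrE// !lnXn//.
have lnr : ln r = (- L)%R by rewrite /L div1r lnV ?posrE// opprK.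
rewrite lnr mulNrn opprK -/l -[leRHS]mulr_natl -[(L *+ d)%R]mulr_natl.
apply: (@le_trans _ _ (M * l)%R); last first.
  by apply: ler_wpM2r; [exact: ltW|rewrite ltW// truncnS_gt].
rewrite /M mulrAC divfK ?gt_eqF// mulrDl lerD2r.
apply: (le_trans (ler_norm _)).
by rewrite ler_peMr.
Qed.

Lemma measurable_bad_points_neq0 (R : realType) (d : nat) (r : R) :
  measurable_fun setT (fun P : {fset euclid R d} => bad_points r P != fset0).
Proof.
have mc : cmeas (fun (_ : unit) (P : {fset euclid R d}) =>
    has (fun x => has (conflict r x) P) P).
  apply: (cmeas_has (p := fun (p : unit * euclid R d) P => has (conflict r p.2) P)).
  exact: (cmeas_comp measurable_snd (@cmeas_conflict R d r)).
apply: eq_measurable_fun (cmeas_measurable tt mc) => P _.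
apply/hasP/fset0Pn => -[x].
  by move=> xP xb; exists x; rewrite mem_bad_points xP.
by rewrite mem_bad_points => /andP[xP xb]; exists x.
Qed.

(** * The two bounds at the chosen value of lambda *)

Section hard_spheres_parameters.
Context (R : realType) (d : nat).
Hypothesis d0 : (0 < d)%N.
Variable r : R.
Hypothesis r0 : (0 < r)%R.

(* Chosen so that the intensity times the volume of a ball of radius [2 * r] is [1 / 2]. *)
Definition hs_lambda : R := (2 ^- d / 2)%R.

Local Notation v := (unit_ball_volume R d).
Local Notation a := (intensity d hs_lambda r).
Let V : R := (v * (2 * r) ^+ d)%R.

Let v0 : (0 < v)%R. Proof. exact: unit_ball_gt0. Qed.
Let rd0 : (0 < r ^+ d)%R. Proof. exact: exprn_gt0. Qed.
Let t0 : (0 < 2 ^+ d :> R)%R. Proof. exact: exprn_gt0. Qed.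

Lemma hs_lambda_gt0 : (0 < hs_lambda)%R.
Proof. by rewrite /hs_lambda divr_gt0// invr_gt0. Qed.

Let a0 : (0 <= a)%R.
Proof. by rewrite /intensity ltW// divr_gt0 ?hs_lambda_gt0// mulr_gt0. Qed.
Let V0 : (0 <= V)%R.
Proof. by rewrite /V ltW// mulr_gt0// exprn_gt0// mulr_gt0. Qed.
Let ballV (x : euclid R d) : volume R d (open_ball x (2 * r)) <= V%:E.
Proof. by apply: volume_open_ball_le; rewrite mulr_gt0. Qed.
Let mu1 (x : euclid R d) : measurable [set x] /\ volume R d [set x] = 0.
Proof. exact: volume_set1. Qed.
Let cube1 := volume_cube R d.

Let aV : (a * V = 1 / 2)%R.
Proof.
rewrite /intensity /V /hs_lambda exprMn; field.
by rewrite !gt_eqF.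
Qed.

Lemma hs_packing_density :
  (3^-1 * 2 ^- d)%:E <= packing_density d hs_lambda r.
Proof.
apply: le_trans (packing_density_ge a0 mu1 cube1 V0 ballV _); last first.
  by rewrite ltW// mulr_gt0.
rewrite lee_fin aV /intensity /hs_lambda.
rewrite (_ : (v * r ^+ d * _ = 3^-1 * 2 ^- d)%R)//.
by field; rewrite !gt_eqF.
Qed.

(** The probability that bad points remain is at most 1 and at most their expected number. The
    prefactor of the latter is [a^2 V = a / 2], which equals [hs_lambda / v / 2 / r ^+ d]. *)
Lemma hs_iterations (d' : measure_display) (Omega : measurableType d')
    (Pr : probability Omega R) (X : nat -> Omega -> {fset euclid R d}) (n : nat) :
  prs_run hs_lambda r Pr X ->
  ((3 / 4) ^+ n * (hs_lambda / v / 2 / r ^+ d) <= 1)%R ->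
  \int[Pr]_w iterations r X w <= (n%:R + 4)%:E.
Proof.
move=> runX hn.
pose u t w : \bar R := (bad_points r (X t w) != fset0)%:R%:E.
have mu_ t : measurable_fun setT (u t).
  apply: measurable_indicator.
  have [mX _ _] := runX.
  exact: (measurable_comp_fun (@measurable_bad_points_neq0 R d r) (mX t)).
apply: (le_trans (integral_iterations_le Pr mu_)).
have u1 t : \int[Pr]_w u t w <= 1.
  rewrite -(@probability_setT _ _ _ Pr) -[leRHS]mul1e -integral_cst//.
  apply: ge0_le_integral => //; first by move=> w _; rewrite lee_fin.
  by move=> w _; rewrite /u lee_fin; case: (_ != _).
have u0 t : 0 <= \int[Pr]_w u t w by apply: integral_ge0 => w _; rewrite lee_fin.
have ufin t : \int[Pr]_w u t w \is a fin_num.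
  by rewrite ge0_fin_numE// (le_lt_trans (u1 t))// ltry.
under eq_eseriesr do rewrite -(fineK (ufin _)).
(* The 4 is the sum of the geometric tail of ratio [3/4]. *)
have -> : (4 = (1 - 3 / 4)^-1 :> R)%R by field.
apply: (@nneseries_geometric_le _ _ _ (hs_lambda / v / 2 / r ^+ d)%R) => //.
- by apply/andP; split; lra.
- by move=> t; rewrite fine_ge0//= -lee_fin fineK.
- move=> t; rewrite -lee_fin fineK//.
  have := expected_bad_points a0 mu1 cube1 runX V0 ballV t.
  rewrite aV (_ : (3 * (1 / 2) ^+ 2 = 3 / 4 :> R)%R); last by field.
  rewrite -mulrA aV (_ : (a * (1 / 2) = hs_lambda / v / 2 / r ^+ d)%R); last first.
    by rewrite /intensity; field; rewrite !gt_eqF.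
  apply: le_trans; apply: ge0_le_integral => //.
  + by move=> w _; rewrite lee_fin.
  + have [mX _ _] := runX.
    exact: (measurable_comp_fun (@measurable_card_bad_points R d r) (mX t)).
  + move=> w _; rewrite /u lee_fin ler_nat -cardfs_gt0.
    by case: (#|` _|).
Qed.

End hard_spheres_parameters.

Local Close Scope ereal_scope.

Theorem mainTheorem4 (R : realType) :
  exists2 c : R, 0 < c &
  forall d : nat, (2 <= d)%N ->
  exists lambda C r0 : R, [/\ 0 < lambda, 0 < C, 0 < r0 < 1 &
  forall r : R, 0 < r <= r0 ->
    (forall (d' : measure_display) (Omega : measurableType d')
        (Pr : probability Omega R) (X : nat -> Omega -> {fset euclid R d}),
      prs_run lambda r Pr X ->
      (\int[Pr]_w iterations r X w <= (C * ln (1 / r))%:E)%E) /\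
    ((c * 2 ^- d)%:E <= packing_density d lambda r)%E].
Proof.
exists (3^-1)%R; first by rewrite invr_gt0.
move=> d d2; have d0 : (0 < d)%N by exact: ltn_trans d2.
have D0 : (0 < hs_lambda R d / unit_ball_volume R d / 2)%R.
  by rewrite !divr_gt0 ?hs_lambda_gt0 ?unit_ball_gt0.
have [C C0 hC] := geometric_time_le_log d D0.
exists (hs_lambda R d), C, (expR (-1)); split => //.
- exact: hs_lambda_gt0.
- by rewrite expR_gt0 expR_lt1 ltrN10.
move=> r /[dup] rr /andP[r0 _]; split; last exact: hs_packing_density.
move=> d' Omega Pr X runX; have [n hn nC] := hC r rr.
by apply: le_trans (hs_iterations d0 r0 runX hn) _; rewrite lee_fin.
Qed.
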